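(* For every real $p\in(1,2]$ there exists a constant $c_p\in(0,2)$ such that $$\Delta_p(n)\ \ge\ (1+o_n(1))\,\frac{\log(2/c_p)\cdot n}{2^n}\qquad (n\to\infty).$$
   Context: $\log$ is the natural logarithm. For $p\ge1$ the $\ell_p$-ball of radius $r$ centered at $\mathbf{x}\in\mathbb{R}^n$ is $\{\mathbf{y}\in\mathbb{R}^n:(\sum_{j=1}^n|x_j-y_j|^p)^{1/p}\le r\}$. Let $r_n$ be the radius for which this ball has volume $1$. $\Delta_p(n)$ denotes the maximum translative packing density of $\ell_p$-balls of volume $1$ in $\mathbb{R}^n$: $$\Delta_p(n)=\limsup_{R\to\infty}\sup_{\mathcal{P}}\frac{\mathrm{vol}\big(B(\mathbf 0,R)\cap\bigcup_{\mathbf{x}\in\mathcal{P}}B(\mathbf{x},r_n)\big)}{\mathrm{vol}(B(\mathbf 0,R))},$$ where $B(\mathbf{x},r)$ is the $\ell_p$-ball and the supremum is over all $\mathcal{P}\subseteq\mathbb{R}^n$ such that the balls $B(\mathbf{x},r_n)$, $\mathbf{x}\in\mathcal{P}$, have pairwise disjoint interiors. *)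

(* Defs.v *)
From HB Require Import structures.
From mathcomp Require Import all_boot all_order all_algebra.
From mathcomp Require Import all_classical all_reals all_analysis.
Set Implicit Arguments. Unset Strict Implicit. Unset Printing Implicit Defensive.
Import Order.TTheory GRing.Theory Num.Theory.
Import numFieldNormedType.Exports.
Local Open Scope classical_set_scope.
Local Open Scope ring_scope.

Definition lpnorm (R : realType) (n : nat) (p : R) (x : 'rV[R]_n) : R :=
  (\sum_(j < n) `|x ord0 j| `^ p) `^ p^-1.

Definition lpball (R : realType) (n : nat) (p : R) (x : 'rV[R]_n) (r : R)
  : set 'rV[R]_n := [set y | lpnorm p (x - y) <= r].

Definition box (R : realType) (n : nat) (a b : 'rV[R]_n) : set 'rV[R]_n :=
  [set y | forall j : 'I_n, a ord0 j <= y ord0 j <= b ord0 j].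
Definition boxvol (R : realType) (n : nat) (a b : 'rV[R]_n) : R :=
  \prod_(j < n) Num.max (b ord0 j - a ord0 j) 0.

(* n-dimensional Lebesgue (outer) measure: infimum of the total volume of
   countable covers by boxes.  It coincides with Lebesgue measure on
   Lebesgue-measurable sets. *)
Definition lvol (R : realType) (n : nat) (A : set 'rV[R]_n) : \bar R :=
  ereal_inf [set s : \bar R | exists a b : nat -> 'rV[R]_n,
     A `<=` \bigcup_k box (a k) (b k) /\
     s = (\sum_(0 <= k <oo) (boxvol (a k) (b k))%:E)%E].

Definition is_packing (R : realType) (n : nat) (p r : R) (P : set 'rV[R]_n) :=
  forall x y, P x -> P y -> x <> y ->
    interior (lpball p x r) `&` interior (lpball p y r) = set0.

Definition cover_ratio (R : realType) (n : nat) (p r T : R) (P : set 'rV[R]_n) : R :=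
  fine (lvol (lpball p (0 : 'rV[R]_n) T `&` \bigcup_(x in P) lpball p x r)) /
  fine (lvol (lpball p (0 : 'rV[R]_n) T)).

(* Delta_p(n) = limsup_{T -> oo} sup_P (covered fraction), the supremum over
   packings P of l_p balls of volume 1 (radius r with vol B(0,r) = 1);
   limsup_{T->oo} f T := inf_M sup_{T >= M} f T. *)
Definition Delta (R : realType) (p : R) (n : nat) : \bar R :=
  ereal_inf [set ereal_sup [set s : \bar R | exists (T r : R) (P : set 'rV[R]_n),
                 [/\ M <= T, lvol (lpball p (0 : 'rV[R]_n) r) = 1%E,
                     is_packing p r P & s = (cover_ratio p r T P)%:E]]
            | M in [set: R]].

(* Main.v *)
Require Import Defs.
From HB Require Import structures.
From mathcomp Require Import all_boot all_order all_algebra.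
From mathcomp Require Import reals sequences exp.
From mathcomp Require Import ring lra.
Set Implicit Arguments. Unset Strict Implicit. Unset Printing Implicit Defensive.
Import Order.TTheory GRing.Theory Num.Theory.
Local Open Scope ring_scope.

(* Since [c] may be chosen close to [2], it suffices to gain a factor of order
   [n] over the greedy density [2^-n].  Join the points of a fine grid of mesh
   [h] in a large ball whenever they are at distance at most [2r]; a stable set
   is the set of centres of a packing.  Degrees are about [d = 2^n / h^n].  By
   uniform convexity of l_p, the common neighbours of two points at distance in
   [(r, 2r]] lie in a ball of radius [2gr] around their midpoint, with [g < 1]
   depending only on [p], so codegrees are at most about [D = (2g)^n / h^n],
   apart from the at most [D] neighbours within distance [r].  In such a graph
   the average size of a stable set in the hard-core model with fugacity of
   order [1/D] is at least a constant times [ln (d/D) / d] times the number of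
   vertices, and [ln (d/D)] is linear in [n].  Outer Lebesgue measure is
   compared with the number of grid points through compactness. *)

(** * Stable sets in graphs with small codegrees *)

Lemma disjoint_setU1 (T : finType) (x : T) (A B : {set T}) :
  [disjoint x |: A & B] = (x \notin B) && [disjoint A & B].
Proof. by rewrite -!setI_eq0 setIUl setU_eq0 !setI_eq0 disjoints1. Qed.

Section HardCore.
Variables (R : realType) (V : finType) (e : rel V).
Hypothesis e_sym : symmetric e.
Hypothesis e_irr : irreflexive e.
Variable l : R.
Hypothesis l_gt0 : 0 < l.

Definition stable (I : {set V}) := [forall x in I, forall y in I, ~~ e x y].
Definition nbr (v : V) : {set V} := [set u | e v u].

Lemma stableP (I : {set V}) :
  reflect {in I &, forall x y, ~~ e x y} (stable I).
Proof.
apply: (iffP forall_inP) => [h x y xI yI|h x xI].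
  by move/forall_inP : (h x xI) => /(_ y yI).
by apply/forall_inP => y yI; exact: h.
Qed.

Lemma stable_sub (I J : {set V}) : I \subset J -> stable J -> stable I.
Proof.
move=> /subsetP sIJ /stableP sJ; apply/stableP => x y xI yI.
by apply: sJ; apply: sIJ.
Qed.

Lemma stableU1 (u : V) (I : {set V}) :
  stable (u |: I) = stable I && [disjoint nbr u & I].
Proof.
apply/idP/andP => [s|[sI dI]].
  split; first by apply: stable_sub s; exact: subsetUr.
  rewrite disjoint_subset; apply/subsetP => y; rewrite !inE => uy.
  apply/negP => yI; move/stableP : s => /(_ u y).
  by rewrite !inE eqxx yI orbT uy => /(_ isT isT).
move/stableP : sI => sI.
move: dI; rewrite disjoint_subset => /subsetP dI.
have nu y : y \in I -> ~~ e u y.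
  by move=> yI; apply/negP => uy; have := dI y; rewrite !inE uy yI => /(_ isT).
apply/stableP => x y; rewrite !inE => /orP[/eqP->|xI] /orP[/eqP->|yI].
- by rewrite e_irr.
- exact: nu.
- by rewrite e_sym nu.
- exact: sI.
Qed.

(* Partition function of the hard-core model with fugacity [l] on the subgraph
   induced by [X]. *)
Definition partition_fun (X : {set V}) : R :=
  \sum_(I : {set V} | (I \subset X) && stable I) l ^+ #|I|.

Lemma stable0 : stable set0.
Proof. by apply/stableP => x y; rewrite inE. Qed.

Lemma weight_ge0 (n : nat) : 0 <= l ^+ n.
Proof. by rewrite exprn_ge0// ltW. Qed.

Lemma partition_fun_ge1 X : 1 <= partition_fun X.
Proof.
rewrite /partition_fun (bigD1 set0)/=; last by rewrite sub0set stable0.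
by rewrite cards0 expr0 lerDl sumr_ge0// => *; exact: weight_ge0.
Qed.

Lemma partition_fun_mono (X Y : {set V}) :
  X \subset Y -> partition_fun X <= partition_fun Y.
Proof.
move=> sXY; rewrite /partition_fun [leRHS]big_mkcond [leLHS]big_mkcond/=.
apply: ler_sum => I _; case: ifPn => [/andP[IX ->]|_].
  by rewrite (fintype.subset_trans IX sXY).
by case: ifP => // _; exact: weight_ge0.
Qed.

(** Divided by [partition_fun X], this is the probability that [u] is occupied. *)
Definition weight_at (X : {set V}) (u : V) : R :=
  \sum_(I : {set V} | [&& I \subset X, stable I & u \in I]) l ^+ #|I|.

(** Removing [u] maps the stable sets through [u] bijectively onto those that avoid [u] and its
    neighbours. *)
Lemma weight_atE (X : {set V}) (u : V) : u \in X ->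
  weight_at X u = l * partition_fun (X :\: (u |: nbr u)).
Proof.
move=> uX; rewrite /weight_at /partition_fun mulr_sumr.
rewrite (reindex_onto (fun I => u |: I) (fun I => I :\ u))/=; last first.
  by move=> I /and3P[_ _ uI]; rewrite finset.setD1K.
apply: eq_big => [I|I /andP[/and3P[]]].
  rewrite stableU1 subUset finset.sub1set uX/= setU11 andbT.
  have -> : ((u |: I) :\ u == I) = (u \notin I).
    apply/eqP/idP => [<-|uI]; first by rewrite !inE eqxx.
    by rewrite setU1K.
  rewrite finset.subsetD (disjoint_sym (mem I)) disjoint_setU1.
  by case: (I \subset X); case: (stable I); case: (u \in I); rewrite ?andbF ?andbT.
move=> _ _ _ /eqP h.
have uI : u \notin I by rewrite -h !inE eqxx.
by rewrite cardsU1 uI exprS.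
Qed.

Lemma weight_at_le (X : {set V}) (u : V) : u \in X ->
  weight_at X u <= l * partition_fun X.
Proof.
move=> uX; rewrite weight_atE// ler_pM2l//.
by apply: partition_fun_mono; exact: subsetDl.
Qed.

(** A stable set contains [u], or misses its closed neighbourhood, or meets [nbr u]. The first two
    kinds weigh [weight_at X u] and [l^-1] times that; a union bound over at most [D] neighbours
    controls the third. *)
Lemma partition_fun_le (X : {set V}) (D : R) (u : V) : u \in X ->
  #|nbr u :&: X|%:R <= D ->
  partition_fun X <= weight_at X u * (1 + l^-1) + D * l * partition_fun X.
Proof.
move=> uX hD.
have -> : weight_at X u * (1 + l^-1) =
    weight_at X u + partition_fun (X :\: (u |: nbr u)).
  by rewrite mulrDr mulr1 weight_atE// [l * _ * l^-1]mulrAC divff ?mul1r ?gt_eqF.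
have hW : \sum_(w in nbr u :&: X) weight_at X w <= D * l * partition_fun X.
  apply: (@le_trans _ _ (\sum_(w in nbr u :&: X) l * partition_fun X)).
    by apply: ler_sum => w; rewrite inE => /andP[_]; exact: weight_at_le.
  rewrite sumr_const -mulr_natl -mulrA ler_wpM2r// mulr_ge0 ?(ltW l_gt0)//.
  exact: le_trans ler01 (partition_fun_ge1 X).
apply: le_trans (lerD (lexx _) hW).
rewrite /weight_at (exchange_big_dep (fun I : {set V} => (I \subset X) && stable I))/=; last first.
  by move=> w I _ /and3P[-> ->].
rewrite /partition_fun.
have E (P : pred {set V}) (Q : pred {set V}) : (forall I, P I -> Q I) ->
    \sum_(I | P I) l ^+ #|I| = \sum_(I | Q I) (if P I then l ^+ #|I| else 0).
  move=> PQ; rewrite [LHS]big_mkcond [RHS]big_mkcond/=; apply: eq_bigr => I _.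
  by case: ifP => [/PQ ->//|]; rewrite if_same.
rewrite (E (fun I : {set V} => [&& I \subset X, stable I & u \in I])
  (fun I : {set V} => (I \subset X) && stable I)); last by move=> I /and3P[-> ->].
rewrite (E (fun I : {set V} => (I \subset X :\: (u |: nbr u)) && stable I)
  (fun I : {set V} => (I \subset X) && stable I)); last first.
  by move=> I /andP[+ ->]; rewrite finset.subsetD => /andP[->].
rewrite -!big_split/=; apply: ler_sum => I /andP[IX sI].
rewrite IX sI/= andbT.
have ge0 : 0 <= \sum_(w in nbr u :&: X | w \in I) l ^+ #|I|.
  by apply: sumr_ge0 => *; exact: weight_ge0.
case: ifP => uI.
  by rewrite -addrA lerDl addr_ge0//; case: ifP => // _; exact: weight_ge0.
rewrite add0r; case: ifP => [_|]; first by rewrite lerDl.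
rewrite finset.subsetD IX/= disjoint_sym disjoint_setU1 uI/= => /negbT.
rewrite -setI_eq0 => /set0Pn[w]; rewrite !inE => /andP[uw wI].
rewrite add0r (bigD1 w)/=; last by rewrite !inE uw wI (subsetP IX).
by rewrite lerDl; apply: sumr_ge0 => *; exact: weight_ge0.
Qed.

(** Splitting on one vertex at a time costs a factor of at most [1 + l <= expR l]. *)
Lemma partition_fun_le_exp (X : {set V}) : partition_fun X <= expR (l * #|X|%:R).
Proof.
have h : forall n (X : {set V}), #|X| = n -> partition_fun X <= (1 + l) ^+ n.
  elim=> [|n IH] {}X.
    move=> /eqP; rewrite cards_eq0 => /eqP ->.
    rewrite /partition_fun (big_pred1 set0); last first.
      by move=> I /=; rewrite subset0; case: eqP => [->|//]; rewrite stable0.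
    by rewrite cards0 !expr0.
  move=> Xn; have /card_gt0P[u uX] : (0 < #|X|)%N by rewrite Xn.
  have cX : #|X :\ u| = n by move: Xn; rewrite (cardsD1 u) uX => -[].
  rewrite exprS mulrDl mul1r.
  rewrite /partition_fun (bigID (fun I : {set V} => u \in I))/= addrC.
  apply: lerD.
    rewrite [leLHS](_ : _ = partition_fun (X :\ u)); first exact: IH.
    by apply: eq_bigl => I; rewrite subsetD1 andbAC.
  rewrite [leLHS](_ : _ = weight_at X u); last first.
    by apply: eq_bigl => I; rewrite andbA.
  rewrite weight_atE// ler_pM2l//; apply: le_trans (IH _ cX).
  by apply: partition_fun_mono; apply: finset.setDS; rewrite finset.sub1set setU11.
apply: le_trans (h _ X erefl) _.
by rewrite expRM_natr lerXn2r ?nnegrE ?expR_ge0 ?addr_ge0 ?(ltW l_gt0) ?expR_ge1Dx.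
Qed.

(** In [partition_fun_le] the term with [D * l] is at most half of the left side, and
    [1 + l^-1 <= 2 / l]. *)
Lemma weight_at_ge (X : {set V}) (D : R) (u : V) : u \in X ->
  #|nbr u :&: X|%:R <= D -> D * l <= 2^-1 -> l <= 1 ->
  l / 4 * partition_fun X <= weight_at X u.
Proof.
move=> uX hD Dl l1; have Z1 := partition_fun_ge1 X.
have h := partition_fun_le uX hD.
have h1 : D * l * partition_fun X <= 2^-1 * partition_fun X.
  by rewrite ler_wpM2r//; lra.
have h2 : 2^-1 * partition_fun X <= weight_at X u * (1 + l^-1) by lra.
have lV : l * (1 + l^-1) = l + 1 by rewrite mulrDr mulr1 divff ?gt_eqF.
have h3 : l * (2^-1 * partition_fun X) <= (l + 1) * weight_at X u.
  by rewrite -lV -[leRHS]mulrA ler_pM2l// [leRHS]mulrC.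
have W0 : 0 <= weight_at X u by apply: sumr_ge0 => *; exact: weight_ge0.
have h4 : (l + 1) * weight_at X u <= 2 * weight_at X u by rewrite ler_wpM2r//; lra.
lra.
Qed.

(** Divided by [partition_fun X], this is the mean size of a random stable set in [X]. *)
Definition size_sum (X : {set V}) : R :=
  \sum_(I : {set V} | (I \subset X) && stable I) l ^+ #|I| * #|I|%:R.

(** Sum [weight_at_ge] over [X :\: A]: each stable set [I] is counted at most [#|I|] times. *)
Lemma size_sum_ge (X A : {set V}) (D : R) :
  (forall u, u \in X :\: A -> #|nbr u :&: X|%:R <= D) ->
  D * l <= 2^-1 -> l <= 1 ->
  l / 4 * #|X :\: A|%:R * partition_fun X <= size_sum X.
Proof.
move=> hD Dl l1.
apply: (@le_trans _ _ (\sum_(u in X :\: A) weight_at X u)).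
  rewrite [leLHS](_ : _ = \sum_(u in X :\: A) l / 4 * partition_fun X); last first.
    by rewrite sumr_const -[RHS]mulr_natr mulrAC.
  apply: ler_sum => u uXA; apply: (weight_at_ge _ (hD u uXA)) => //.
  by move: uXA; rewrite inE => /andP[].
rewrite /weight_at (exchange_big_dep (fun I : {set V} => (I \subset X) && stable I))/=; last first.
  by move=> u I _ /and3P[-> ->].
apply: ler_sum => I /andP[-> ->]/=.
rewrite sumr_const -[leLHS]mulr_natr ler_wpM2l ?weight_ge0// ler_nat.
by apply: subset_leq_card; apply/subsetP => u /andP[].
Qed.

(** Here [X] stands for the neighbours of a vertex [v] that remain free once everything outside its
    closed neighbourhood is fixed, and [l] is the weight of choosing [v] itself. If [X] is large,
    many neighbours are occupied on average; if it is small, [partition_fun X] is at most twice the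
    square root of [d * l], and the reward [d * l] for [v] suffices. *)
Lemma local_occupancy (X A : {set V}) (D d : R) :
  #|A|%:R <= D -> (forall u, u \in X :\: A -> #|nbr u :&: X|%:R <= D) ->
  D * l <= 2^-1 -> l <= 1 -> 1 <= d * l ->
  ln (d * l) / 16 * (l + partition_fun X) <= d * l + size_sum X.
Proof.
move=> hA hD Dl l1 dl1.
have Z1 := partition_fun_ge1 X; have M1 := size_sum_ge hD Dl l1.
have M0 : 0 <= size_sum X.
  by apply: sumr_ge0 => I _; rewrite mulr_ge0 ?weight_ge0.
set y := #|X :\: A|%:R in M1; have y0 : 0 <= y by rewrite /y.
set L := ln (d * l).
have L0 : 0 <= L by exact: ln_ge0.
have hZ : L / 16 * (l + partition_fun X) <= L / 8 * partition_fun X.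
  rewrite (_ : L / 8 * _ = L / 16 * (2 * partition_fun X)); last by lra.
  by rewrite ler_wpM2l//; lra.
apply: le_trans hZ _.
have [hy|hy] := lerP (L / 2) (l * y).
  apply: (@le_trans _ _ (size_sum X)); last by lra.
  by apply: le_trans M1; rewrite ler_wpM2r//; lra.
have dl0 : 0 < d * l by lra.
(* The square root of [d * l], which dominates its logarithm. *)
pose q := expR (L / 2).
have q0 : 0 < q by exact: expR_gt0.
have qq : q * q = d * l.
  by rewrite /q -expRD (_ : L / 2 + L / 2 = L) ?lnK//; lra.
have qL : 1 + L / 2 <= q by exact: expR_ge1Dx.
have Z2 : partition_fun X <= 2 * q.
  apply: le_trans (partition_fun_le_exp X) _.
  have e2 : expR (2^-1 : R) <= 2.
    have := @expR_ge1Dx R (- 2^-1); rewrite expRN => h.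
    have e0 := @expR_gt0 R 2^-1.
    have : expR 2^-1 * (1 - 2^-1) <= (1 : R).
      rewrite -[leRHS](@divff _ (expR 2^-1 : R)) ?gt_eqF//.
      by rewrite ler_pM2l.
    by lra.
  apply: (@le_trans _ _ (expR (2^-1 + L / 2))).
    rewrite ler_expR; apply: (@le_trans _ _ (l * (#|A|%:R + y))).
      rewrite ler_pM2l// /y -natrD ler_nat -(cardsID A X) leq_add2r.
      by apply: subset_leq_card; exact: subsetIr.
    rewrite mulrDr lerD//; last exact: ltW.
    by apply: le_trans Dl; rewrite mulrC ler_wpM2r// ltW.
  by rewrite expRD ler_pM2r.
apply: (@le_trans _ _ (d * l)); last by rewrite lerDl.
rewrite -qq; apply: (@le_trans _ _ (L / 8 * (2 * q))).
  by rewrite ler_wpM2l//; lra.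
by rewrite mulrA ler_pM2r//; lra.
Qed.

(* A stable set that agrees with [J] outside the closed neighbourhood of [v]
   either contains [v], or meets the neighbourhood in a stable set of vertices
   that are not adjacent to [J]. *)
Lemma big_stable_fiber (v : V) (J : {set V}) (F : {set V} -> R) :
  stable J -> [disjoint v |: nbr v & J] ->
  \sum_(I : {set V} | stable I && (I :\: (v |: nbr v) == J)) F I =
  F (v |: J) +
  \sum_(K : {set V} | (K \subset [set u in nbr v | [disjoint nbr u & J]]) && stable K)
     F (K :|: J).
Proof.
move=> sJ; rewrite disjoint_setU1 => /andP[vJ dJ].
have JN : J :\: (v |: nbr v) = J.
  by apply/setDidPl; rewrite disjoint_sym disjoint_setU1 vJ.
have NJ x : x \in J -> x \notin v |: nbr v.
  by move=> xJ; move: (xJ); rewrite -{1}JN inE => /andP[].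
rewrite (bigD1 (v |: J))/=; last first.
  rewrite stableU1 sJ dJ/= finset.setDUl JN; apply/eqP/setP => x.
  by rewrite in_setU in_setD in_setU1 in_set1; case: (x == v); rewrite ?andbF.
congr (_ + _).
rewrite (reindex_onto (fun K => K :|: J) (fun I => I :&: (v |: nbr v)))/=; last first.
  by move=> I /andP[/andP[_ /eqP IJ] _]; rewrite -[in RHS](finset.setID I (v |: nbr v)) IJ.
apply: eq_bigl => K; apply/idP/idP.
  move=> /andP[/andP[/andP[sKJ _] KvJ] /eqP KN].
  have sK : stable K by apply: stable_sub sKJ; exact: subsetUl.
  have KNv x : x \in K -> x \in v |: nbr v by rewrite -{1}KN inE => /andP[].
  (* With [v] in [K], stability forces [K] to be the singleton of [v], the case already split
     off. *)
  have vK : v \notin K.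
    apply/negP => vK; move/eqP : KvJ; apply; congr (_ :|: _).
    apply/setP => x; rewrite inE; apply/idP/eqP => [xK|->//].
    move: (KNv x xK); rewrite !inE => /orP[/eqP//|vx].
    by move/stableP : sK => /(_ v x vK xK); rewrite vx.
  rewrite sK andbT; apply/subsetP => x xK; rewrite inE.
  move: (KNv x xK); rewrite !inE => /orP[/eqP xv|->/=].
    by rewrite xv (negbTE vK) in xK *.
  rewrite disjoint_subset; apply/subsetP => y; rewrite !inE => xy.
  apply/negP => yJ; move/stableP : sKJ => /(_ x y).
  by rewrite !inE xK yJ orbT xy => /(_ isT isT).
move=> /andP[/subsetP KX sK].
have KNv x : x \in K -> x \in nbr v by move=> /KX; rewrite inE => /andP[].
have vK : v \notin K by apply/negP => /KNv; rewrite inE e_irr.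
have KJn x y : x \in K -> y \in J -> ~~ e x y.
  move=> /KX; rewrite inE => /andP[_]; rewrite disjoint_subset => /subsetP h yJ.
  by apply/negP => xy; move: (h y); rewrite !inE xy yJ => /(_ isT).
apply/andP; split; [apply/andP; split; [apply/andP; split|]|].
- apply/stableP => x y; rewrite !inE => /orP[xK|xJ] /orP[yK|yJ].
  + by move/stableP : sK; apply.
  + exact: KJn.
  + by rewrite e_sym KJn.
  + by move/stableP : sJ; apply.
- rewrite finset.setDUl JN; apply/eqP/setP => x; rewrite in_setU in_setD.
  case: (boolP (x \in K)) => [/KNv xN|_]; last by rewrite andbF.
  rewrite in_setU1 xN orbT/=.
  by case: (boolP (x \in J)) => // /NJ; rewrite in_setU1 xN orbT.
- apply/negP => /eqP /setP /(_ v).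
  by rewrite !inE eqxx (negbTE vK) (negbTE vJ).
- apply/eqP/setP => x; rewrite in_setI in_setU.
  case: (boolP (x \in K)) => [/KNv xN|_]/=; first by rewrite in_setU xN orbT.
  by apply/andP => -[/NJ/negP].
Qed.

(** Condition on [J], the part of the stable set outside the closed neighbourhood of [v]: each fibre
    is an instance of [local_occupancy], scaled by [l ^+ #|J|]. *)
Lemma vertex_occupancy (v : V) (A : {set V}) (D d : R) :
  #|A|%:R <= D ->
  (forall u, u \in nbr v :\: A -> #|nbr u :&: nbr v|%:R <= D) ->
  D * l <= 2^-1 -> l <= 1 -> 1 <= d * l ->
  ln (d * l) / 16 * \sum_(I : {set V} | stable I) l ^+ #|I| <=
  \sum_(I : {set V} | stable I)
     l ^+ #|I| * (d * (v \in I)%:R + #|nbr v :&: I|%:R).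
Proof.
move=> hA hD Dl l1 dl1.
have d0 : 0 <= d.
  by rewrite -(pmulr_lge0 _ l_gt0); apply: le_trans ler01 dl1.
pose Q (J : {set V}) := stable J && [disjoint v |: nbr v & J].
have hQ (I : {set V}) : stable I -> Q (I :\: (v |: nbr v)).
  move=> sI; rewrite /Q (stable_sub (subsetDl _ _) sI)/=.
  by rewrite disjoint_sym disjoint_subset; apply/subsetP => x; rewrite !inE => /andP[].
rewrite !(partition_big _ _ hQ)/= mulr_sumr; apply: ler_sum => J /andP[sJ dJ].
rewrite !big_stable_fiber//.
set X := [set u in nbr v | _].
move: (dJ); rewrite disjoint_setU1 => /andP[vJ dJ'].
have XJ (K : {set V}) : K \subset X -> [disjoint K & J].
  move=> KX; rewrite disjoint_sym; apply: disjointWr KX _.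
  rewrite disjoint_sym; apply: disjointWl dJ'.
  by apply/subsetP => x; rewrite inE => /andP[].
have cU (K : {set V}) : K \subset X -> #|K :|: J| = (#|K| + #|J|)%N.
  by move=> /XJ; rewrite -setI_eq0 => /eqP KJ; rewrite cardsU KJ cards0 subn0.
have -> : l ^+ #|v |: J| + \sum_(K : {set V} | (K \subset X) && stable K) l ^+ #|K :|: J| =
    (l + partition_fun X) * l ^+ #|J|.
  rewrite cardsU1 vJ exprS mulrDl; congr (_ + _).
  rewrite /partition_fun mulr_suml; apply: eq_bigr => K /andP[/cU -> _].
  by rewrite exprD.
apply: (@le_trans _ _ ((d * l + size_sum X) * l ^+ #|J|)).
  rewrite mulrA ler_wpM2r ?weight_ge0//.
  apply: (local_occupancy hA) => // u; rewrite inE => /andP[uA uX].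
  apply: le_trans (hD u _); last first.
    by rewrite inE uA; move: uX; rewrite inE => /andP[].
  rewrite ler_nat; apply/subset_leq_card/finset.setIS/subsetP => x.
  by rewrite inE => /andP[].
rewrite mulrDl lerD//.
  rewrite cardsU1 vJ exprS setU11 mulr1 [leLHS](_ : _ = l * l ^+ #|J| * d); last by ring.
  by rewrite ler_wpM2l ?lerDl// mulr_ge0 ?weight_ge0 ?ltW.
rewrite /size_sum mulr_suml; apply: ler_sum => K /andP[KX sK].
rewrite (cU _ KX) exprD mulrAC ler_wpM2l ?mulr_ge0 ?weight_ge0//.
rewrite (le_trans (y := #|nbr v :&: (K :|: J)|%:R))//; last first.
  by rewrite lerDr mulr_ge0.
rewrite ler_nat; apply/subset_leq_card/subsetP => x xK; rewrite in_setI in_setU xK andbT.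
by move/subsetP : KX => /(_ x xK); rewrite inE => /andP[].
Qed.

End HardCore.

(** Sum [vertex_occupancy] over [v]. By double counting, a stable set [I] contributes at most
    [2 * d * #|I|] times its weight, so the mean size, and hence the largest size, reaches the
    bound. [A v] holds the exceptional vertices, whose codegree with [v] is not bounded. *)
Theorem large_stable_set (R : realType) (V : finType) (e : rel V)
    (A : V -> {set V}) (D d l : R) :
  symmetric e -> irreflexive e ->
  (forall v, #|nbr e v|%:R <= d) -> (forall v, #|A v|%:R <= D) ->
  (forall v u, u \in nbr e v :\: A v -> #|nbr e u :&: nbr e v|%:R <= D) ->
  0 < l -> l <= 1 -> D * l <= 2^-1 -> 1 <= d * l ->
  exists2 I : {set V}, stable e I & #|V|%:R * ln (d * l) / (32 * d) <= #|I|%:R.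
Proof.
move=> e_sym e_irr hd hA hD l0 l1 Dl dl.
have d0 : 0 < d by rewrite -(pmulr_lgt0 _ l0); apply: lt_le_trans ltr01 dl.
pose m := [arg max_(I > (set0 : {set V}) | stable e I) #|I|].
have [sm hm] : stable e m /\ forall I, stable e I -> (#|I| <= #|m|)%N.
  by rewrite /m; case: arg_maxnP => //; exact: stable0.
exists m => //.
pose Z := \sum_(I : {set V} | stable e I) l ^+ #|I|.
have Z0 : 0 < Z.
  apply: lt_le_trans ltr01 _; apply: le_trans (partition_fun_ge1 e l0 [set: V]) _.
  by rewrite /partition_fun (eq_bigl (stable e)) // => I; rewrite subsetT.
have h : #|V|%:R * (ln (d * l) / 16 * Z) <= 2 * d * #|m|%:R * Z.
  apply: (@le_trans _ _ (\sum_(v : V) \sum_(I : {set V} | stable e I)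
     l ^+ #|I| * (d * (v \in I)%:R + #|nbr e v :&: I|%:R))).
    rewrite mulr_natl -[#|V|]cardsT -sumr_const big_mkcond/= [leLHS]big_mkcond/=.
    apply: ler_sum => v _; rewrite inE.
    exact: (vertex_occupancy e_sym e_irr l0 (hA v) (hD v)).
  rewrite exchange_big/= mulr_sumr; apply: ler_sum => I sI.
  rewrite -mulr_sumr [leRHS]mulrC ler_wpM2l ?exprn_ge0 ?(ltW l0)//.
  rewrite big_split/= -mulr_sumr.
  have -> : \sum_(v : V) (v \in I)%:R = #|I|%:R :> R.
    rewrite -sum1_card natr_sum [RHS]big_mkcond/=; apply: eq_bigr => v _.
    by case: (v \in I).
  have : \sum_(v : V) #|nbr e v :&: I|%:R <= d * #|I|%:R :> R.
    rewrite (eq_bigr (fun v => \sum_(u in I) (e v u)%:R)); last first.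
      move=> v _; rewrite -natr_sum -sum1_card; congr (_%:R).
      rewrite big_mkcond [RHS]big_mkcond/=; apply: eq_bigr => u _.
      by rewrite !inE; case: (e v u); case: (u \in I).
    rewrite exchange_big/= mulr_natr -sumr_const; apply: ler_sum => u uI.
    apply: le_trans (hd u); rewrite -natr_sum ler_nat -sum1_card.
    rewrite [leqRHS]big_mkcond/=; apply: leq_sum => v _.
    by rewrite inE e_sym; case: (e u v).
  have : d * #|I|%:R <= d * #|m|%:R by rewrite ler_pM2l// ler_nat hm.
  by lra.
rewrite ler_pdivrMr ?mulr_gt0//.
move: h; rewrite !mulrA ler_pM2r//; lra.
Qed.

From mathcomp Require Import all_classical all_reals all_analysis.
Import numFieldNormedType.Exports.
Local Open Scope classical_set_scope.
Local Open Scope ring_scope.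

(** * Uniform convexity of the l_p norm *)

Section PowerConvexity.
Variables (R : realType) (p : R).

Lemma powR_le_conv (t a b : R) : 1 <= p -> 0 <= t <= 1 -> 0 <= a -> 0 <= b ->
  (t * a + (1 - t) * b) `^ p <= t * a `^ p + (1 - t) * b `^ p.
Proof.
move=> p1 /andP[t0 t1] a0 b0.
have := @convex_powR R p p1 (Itv01 t0 t1) a b.
rewrite !inE/= !in_itv/= a0 b0 !convRE => h; exact: h.
Qed.

Lemma powR_mid (a b : R) : 1 <= p -> 0 <= a -> 0 <= b ->
  ((a + b) / 2) `^ p <= (a `^ p + b `^ p) / 2.
Proof.
move=> p1 a0 b0; have := @powR_le_conv 2^-1 a b p1 _ a0 b0.
have -> : 2^-1 * a + (1 - 2^-1) * b = (a + b) / 2 by lra.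
have -> : 2^-1 * a `^ p + (1 - 2^-1) * b `^ p = (a `^ p + b `^ p) / 2 by lra.
by apply; lra.
Qed.

Lemma powR_inv (a : R) : 0 <= a -> a^-1 `^ p = (a `^ p)^-1.
Proof. by move=> a0; rewrite -powR_inv1// -powRrM mulN1r powRN. Qed.

Lemma ler_powRl (a b : R) : 1 <= p -> 0 <= a -> a <= b -> a `^ p <= b `^ p.
Proof.
move=> p1 a0 ab; apply: ge0_ler_powR => //; rewrite ?nnegrE; first lra.
exact: le_trans ab.
Qed.

(** Strict Bernoulli inequality. With [s = ln a], the bound [1 - s < expR (- s)] gives
    [a - 1 < a * s], while [expR ((p - 1) * s)] is at least [1 + (p - 1) * s]. *)
Lemma powR_gt1Dx (a : R) : 1 < p -> 0 < a -> a != 1 ->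
  1 + p * (a - 1) < a `^ p.
Proof.
move=> p1 a0 a1; set s := ln a.
have sa : expR s = a by rewrite /s lnK.
have s0 : s != 0.
  by apply: contra a1 => /eqP s0; rewrite -sa s0 expR0.
have e1 : 1 + - s < expR (- s) by rewrite expR_gt1Dx ?oppr_eq0.
have ae : a * expR (- s) = 1 by rewrite expRN sa divff ?gt_eqF.
have as1 : a * (1 + - s) < 1 by rewrite -[ltRHS]ae ltr_pM2l.
have -> : a `^ p = a * expR ((p - 1) * s).
  by rewrite /powR gt_eqF// -/s -[in RHS]sa -expRD; congr expR; lra.
have e2 := expR_ge1Dx ((p - 1) * s).
have : a * (1 + (p - 1) * s) <= a * expR ((p - 1) * s) by rewrite ler_pM2l.
have : 0 < (p - 1) * (1 - a * (1 + - s)) by apply: mulr_gt0; lra.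
lra.
Qed.

(** Both [1 + y] and [1 - y] are convex combinations of [1 + x] and [1 - x], with the weights [t]
    and [1 - t] exchanged, so convexity can be added up. *)
Lemma powR_spread (x y : R) : 1 <= p -> 0 < y -> y <= x -> x <= 1 ->
  (1 + y) `^ p + (1 - y) `^ p <= (1 + x) `^ p + (1 - x) `^ p.
Proof.
move=> p1 y0 yx x1; have x0 : 0 < x by exact: lt_le_trans yx.
pose t := (y / x + 1) / 2.
have yx1 : y / x <= 1 by rewrite ler_pdivrMr// mul1r.
have yx0 : 0 <= y / x by rewrite divr_ge0 ?ltW.
have t01 : 0 <= t <= 1 by rewrite /t; lra.
have tx : t * x = (y + x) / 2 by rewrite /t; field; rewrite gt_eqF.
have h1 := @powR_le_conv t (1 + x) (1 - x) p1 t01.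
have h2 := @powR_le_conv t (1 - x) (1 + x) p1 t01.
have e1 : t * (1 + x) + (1 - t) * (1 - x) = 1 + y by lra.
have e2 : t * (1 - x) + (1 - t) * (1 + x) = 1 - y by lra.
rewrite e1 in h1; rewrite e2 in h2.
have g1 := h1 ltac:(lra) ltac:(lra); have g2 := h2 ltac:(lra) ltac:(lra).
lra.
Qed.

(** For equal signs, the absolute values are [m * (1 + x)] and [m * (1 - x)] with [x >= 1/8], and
    [powR_spread] gains the factor [2 / f]. For opposite signs, the midpoint is at most half the
    larger absolute value, which gains [c], that is [2 ^ (1 - p)]. *)
Lemma powR_uniformly_convex : 1 < p ->
  exists2 q : R, 0 <= q < 1 & forall s t : R, `|s| + `|t| <= 8 * `|s - t| ->
    `|(s + t) / 2| `^ p <= q * ((`|s| `^ p + `|t| `^ p) / 2).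
Proof.
move=> p1; have p1' := ltW p1.
pose f := (1 + 8^-1 : R) `^ p + (1 - 8^-1) `^ p.
(* The linear terms of the two strict Bernoulli inequalities cancel. *)
have f2 : 2 < f.
  have := @powR_gt1Dx (1 + 8^-1) p1 ltac:(lra) ltac:(lra).
  have := @powR_gt1Dx (1 - 8^-1) p1 ltac:(lra) ltac:(lra).
  by rewrite /f; lra.
pose c := (2 : R) * 2^-1 `^ p.
have c0 : 0 < c by rewrite mulr_gt0// powR_gt0.
have c1 : c < 1.
  have h : 2^-1 `^ p < (2^-1 : R).
    rewrite -[ltRHS]powRr1; last by lra.
    by rewrite /powR gt_eqF ?ltr_expR ?ltr_nM2r ?ln_lt0//; lra.
  by rewrite /c; lra.
pose q := Num.max c (2 / f).
have qf : 2 / f <= q by rewrite le_max lexx orbT.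
have qc : c <= q by rewrite le_max lexx.
exists q.
  rewrite (le_trans (ltW c0) qc)/= gt_max c1/= ltr_pdivrMr ?mul1r//; lra.
move=> s t.
have same (a b : R) : 0 <= b -> b <= a -> a + b <= 8 * (a - b) ->
    ((a + b) / 2) `^ p <= q * ((a `^ p + b `^ p) / 2).
  move=> b0 ba ab.
  have [m0|m0] := lerP (a + b) 0.
    have -> : (a + b) / 2 = 0 by lra.
    rewrite powR0; last by lra.
    by rewrite mulr_ge0 ?divr_ge0 ?addr_ge0 ?powR_ge0//; lra.
  pose m := (a + b) / 2; pose x := (a - b) / (a + b).
  have mx : m * x = (a - b) / 2 by rewrite /m /x; field; rewrite gt_eqF.
  have x8 : 8^-1 <= x by rewrite /x ler_pdivlMr//; lra.
  have x1 : x <= 1 by rewrite /x ler_pdivrMr//; lra.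
  have m0' : 0 <= m by rewrite /m; lra.
  have -> : a = m * (1 + x) by rewrite mulrDr mulr1 mx /m; lra.
  have -> : b = m * (1 - x) by rewrite mulrBr mulr1 mx /m; lra.
  have -> : (m * (1 + x) + m * (1 - x)) / 2 = m by lra.
  have -> : (m * (1 + x)) `^ p = m `^ p * (1 + x) `^ p by rewrite powRM//; lra.
  have -> : (m * (1 - x)) `^ p = m `^ p * (1 - x) `^ p by rewrite powRM//; lra.
  have := @powR_spread x 8^-1 p1' ltac:(lra) x8 x1; rewrite -/f => hf.
  have mp := @powR_ge0 R m p.
  have qf1 : 2 <= q * f by rewrite -ler_pdivrMr//; lra.
  have q0 : 0 <= q by lra.
  set F := (X in _ <= q * X).
  have hF : m `^ p * f / 2 <= F.
    rewrite /F -mulrDr ler_pM2r; last by lra.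
    by rewrite ler_wpM2l.
  have : q * (m `^ p * f / 2) <= q * F by rewrite ler_wpM2l.
  have : m `^ p * 2 <= m `^ p * (q * f) by rewrite ler_wpM2l.
  lra.
have opp (a b : R) : 0 <= b -> b <= a ->
    ((a - b) / 2) `^ p <= q * ((a `^ p + b `^ p) / 2).
  move=> b0 ba; have bp := @powR_ge0 R b p; have ap := @powR_ge0 R a p.
  apply: (@le_trans _ _ (c * ((a `^ p + b `^ p) / 2))); last first.
    by rewrite ler_wpM2r//; lra.
  apply: (@le_trans _ _ ((a / 2) `^ p)).
    by apply: ler_powRl => //; lra.
  rewrite powRM; [|lra|lra]; rewrite /c.
  have : 0 <= 2^-1 `^ p * b `^ p by rewrite mulr_ge0 ?powR_ge0.
  lra.
have sym (u v : R) : `|(u + v) / 2| = `|(v + u) / 2| by rewrite addrC.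
wlog ts : s t / `|t| <= `|s|.
  move=> h; have [ts|/ltW st] := lerP `|t| `|s|; first exact: h.
  by rewrite distrC [`|s| + _]addrC [s + t]addrC [`|s| `^ p + _]addrC; exact: h.
move=> hst.
have [s0|s0] := lerP 0 s; have [t0|t0] := lerP 0 t.
- move: hst ts; rewrite (ger0_norm s0) (ger0_norm t0) => hst ts.
  rewrite !ger0_norm in hst *; try lra.
  exact: same.
- move: hst ts; rewrite (ger0_norm s0) (ltr0_norm t0) => hst ts.
  rewrite ger0_norm; last by lra.
  by have := @opp s (- t) ltac:(lra) ltac:(lra); rewrite opprK.
- move: hst ts; rewrite (ltr0_norm s0) (ger0_norm t0) => hst ts.
  rewrite ler0_norm; last by lra.
  have := @opp (- s) t ltac:(lra) ltac:(lra).
  by have -> : (- s - t) / 2 = - ((s + t) / 2) by lra.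
- move: hst ts; rewrite (ltr0_norm s0) (ltr0_norm t0) => hst ts.
  rewrite !ler0_norm in hst *; try lra.
  have := @same (- s) (- t) ltac:(lra) ltac:(lra) ltac:(lra).
  by have -> : (- s - t) / 2 = - ((s + t) / 2) by lra.
Qed.

End PowerConvexity.

(** * Norm properties of the l_p norm *)

Section LpNorm.
Variables (R : realType) (p : R).
Hypothesis p1 : 1 <= p.

Let p0 : 0 < p. Proof. exact: lt_le_trans ltr01 p1. Qed.

Definition lpsum (n : nat) (x : 'rV[R]_n) : R := \sum_(j < n) `|x ord0 j| `^ p.

Lemma lpsum_ge0 n (x : 'rV[R]_n) : 0 <= lpsum x.
Proof. by apply: sumr_ge0 => j _; exact: powR_ge0. Qed.

Lemma lpnorm_ge0 n (x : 'rV[R]_n) : 0 <= lpnorm p x.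
Proof. exact: powR_ge0. Qed.

Lemma lpnorm_powR n (x : 'rV[R]_n) : lpnorm p x `^ p = lpsum x.
Proof.
by rewrite /lpnorm -powRrM mulVf ?gt_eqF// powRr1//; exact: lpsum_ge0.
Qed.

Lemma powR_le_mono (a b : R) : 0 <= a -> 0 <= b -> (a `^ p <= b `^ p) = (a <= b).
Proof.
move=> a0 b0; apply/idP/idP => [|ab]; last exact: ler_powRl.
apply: contraTT; rewrite -!ltNge => ba.
by apply: gt0_ltr_powR; rewrite ?nnegrE.
Qed.

Lemma lpnorm_leE n (x : 'rV[R]_n) (r : R) : 0 <= r ->
  (lpnorm p x <= r) = (lpsum x <= r `^ p).
Proof. by move=> r0; rewrite -lpnorm_powR powR_le_mono// lpnorm_ge0. Qed.

Lemma lpsumZ n (c : R) (x : 'rV[R]_n) : lpsum (c *: x) = `|c| `^ p * lpsum x.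
Proof.
by rewrite /lpsum mulr_sumr; apply: eq_bigr => j _; rewrite mxE normrM powRM.
Qed.

Lemma lpnormZ n (c : R) (x : 'rV[R]_n) : lpnorm p (c *: x) = `|c| * lpnorm p x.
Proof.
rewrite {1}/lpnorm -/(lpsum _) lpsumZ powRM ?powR_ge0 ?lpsum_ge0//.
by rewrite -powRrM divff ?gt_eqF// powRr1.
Qed.

Lemma lpnormN n (x : 'rV[R]_n) : lpnorm p (- x) = lpnorm p x.
Proof. by rewrite -scaleN1r lpnormZ normrN1 mul1r. Qed.

Lemma lpnorm_distC n (x y : 'rV[R]_n) : lpnorm p (x - y) = lpnorm p (y - x).
Proof. by rewrite -lpnormN opprB. Qed.

Lemma coord_le_lpnorm n (x : 'rV[R]_n) j : `|x ord0 j| <= lpnorm p x.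
Proof.
rewrite -powR_le_mono ?lpnorm_ge0// lpnorm_powR /lpsum (bigD1 j)//=.
by rewrite lerDl; apply: sumr_ge0 => *; exact: powR_ge0.
Qed.

Lemma lpnorm_eq0 n (x : 'rV[R]_n) : lpnorm p x = 0 -> x = 0.
Proof.
move=> x0; apply/rowP => j; apply/eqP; rewrite mxE -normr_eq0 eq_le normr_ge0.
by rewrite andbT -x0 coord_le_lpnorm.
Qed.

(** The crude factor [n] is harmless, since meshes are chosen after [n]. *)
Lemma lpnorm_le_bound n (x : 'rV[R]_n) (t : R) : 0 <= t ->
  (forall j, `|x ord0 j| <= t) -> lpnorm p x <= n%:R * t.
Proof.
move=> t0 xt; rewrite lpnorm_leE ?mulr_ge0//.
apply: (@le_trans _ _ (\sum_(j < n) t `^ p)).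
  by apply: ler_sum => j _; exact: ler_powRl.
rewrite sumr_const card_ord -[leLHS]mulr_natl powRM// ler_wpM2r ?powR_ge0//.
by case: n {x xt} => [|n]; [exact: powR_ge0|apply: le1r_powR; rewrite ?ler1n].
Qed.

(** Minkowski: normalise [x] and [y], and apply convexity of the power in each coordinate with
    weights [t = a / (a + b)] and [1 - t]. *)
Lemma lpnormD n (x y : 'rV[R]_n) : lpnorm p (x + y) <= lpnorm p x + lpnorm p y.
Proof.
move Ea : (lpnorm p x) => a; move Eb : (lpnorm p y) => b.
have a0 : 0 <= a by rewrite -Ea lpnorm_ge0.
have b0 : 0 <= b by rewrite -Eb lpnorm_ge0.
have [ab0|ab0] := lerP (a + b) 0.
  have -> : x = 0 by apply: lpnorm_eq0; rewrite Ea; clear -ab0 a0 b0; lra.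
  by rewrite add0r Eb lerDr.
have [ea|ea] := eqVneq a 0.
  by rewrite ea in Ea; rewrite (lpnorm_eq0 Ea) add0r Eb lerDr.
have [eb|eb] := eqVneq b 0.
  by rewrite eb in Eb; rewrite (lpnorm_eq0 Eb) addr0 Ea lerDl.
have a0' : 0 < a by rewrite lt0r ea.
have b0' : 0 < b by rewrite lt0r eb.
rewrite lpnorm_leE ?addr_ge0//.
pose t := a / (a + b).
have t01 : 0 <= t <= 1.
  by rewrite /t divr_ge0 ?addr_ge0//= ler_pdivrMr// mul1r lerDl.
have ta : t * (a + b) / a = 1 by rewrite /t; field; rewrite !gt_eqF.
have tb : (1 - t) * (a + b) / b = 1 by rewrite /t; field; rewrite !gt_eqF.
apply: (@le_trans _ _ (\sum_(j < n) (a + b) `^ p *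
    (t * (`|x ord0 j| `^ p / a `^ p) + (1 - t) * (`|y ord0 j| `^ p / b `^ p)))).
  apply: ler_sum => j _; rewrite mxE.
  have -> : `|x ord0 j| `^ p / a `^ p = (`|x ord0 j| / a) `^ p.
    by rewrite powRM ?invr_ge0// powR_inv.
  have -> : `|y ord0 j| `^ p / b `^ p = (`|y ord0 j| / b) `^ p.
    by rewrite powRM ?invr_ge0// powR_inv.
  have := @powR_le_conv R p t (`|x ord0 j| / a) (`|y ord0 j| / b) p1 t01.
  rewrite !divr_ge0// => /(_ isT isT) h.
  apply: (@le_trans _ _ ((a + b) `^ p *
      (t * (`|x ord0 j| / a) + (1 - t) * (`|y ord0 j| / b)) `^ p)); last first.
    by rewrite ler_wpM2l ?powR_ge0.
  rewrite -powRM; [|exact: addr_ge0|]; last first.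
    by case/andP: t01 => t0 t1; apply: addr_ge0; apply: mulr_ge0;
    rewrite ?subr_ge0 ?divr_ge0 ?addr_ge0.
  apply: ler_powRl => //; rewrite mulrDr.
  have -> : (a + b) * (t * (`|x ord0 j| / a)) = t * (a + b) / a * `|x ord0 j| by ring.
  have -> : (a + b) * ((1 - t) * (`|y ord0 j| / b)) = (1 - t) * (a + b) / b * `|y ord0 j|.
    by ring.
  by rewrite ta tb !mul1r ler_normD.
rewrite -mulr_sumr big_split/= -!mulr_sumr -!mulr_suml -/(lpsum x) -/(lpsum y).
by rewrite -!lpnorm_powR Ea Eb !divff ?gt_eqF ?powR_gt0// !mulr1 subrKC mulr1.
Qed.

Lemma lpnorm_triangle n (x y z : 'rV[R]_n) :
  lpnorm p (x - z) <= lpnorm p (x - y) + lpnorm p (y - z).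
Proof. by rewrite -[x - z](subrKA y); exact: lpnormD. Qed.

End LpNorm.

(* The coordinates with [8 |a_j - b_j| < |a_j| + |b_j|] carry only a small part
   of [|a - b|^p], so the others, where the midpoint inequality has a definite
   gain, carry a definite part of [|a|^p + |b|^p]. *)
Lemma lpnorm_uniformly_convex (R : realType) (p : R) : 1 < p ->
  exists2 g : R, 2^-1 <= g < 1 & forall n (a b : 'rV[R]_n) (r : R), 0 < r ->
    lpnorm p a <= r -> lpnorm p b <= r -> r / 2 <= lpnorm p (a - b) ->
    lpnorm p (2^-1 *: (a + b)) <= g * r.
Proof.
move=> p1; have p1' := ltW p1.
have p0 : 0 < p by lra.
have [q /andP[q0 q1] hq] := powR_uniformly_convex p1.
pose h : R := 2^-1 `^ p.
have h0 : 0 < h by exact: powR_gt0.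
have h1 : h < 1.
  have : h < 1 `^ p by apply: gt0_ltr_powR; rewrite ?nnegrE//; lra.
  by rewrite powR1.
(* A lower bound for the share of the coordinates in [P], obtained by solving [h <= S / h + h * h]
   for [S]. *)
pose k := h * (h - h * h).
have k0 : 0 < k.
  by rewrite /k mulr_gt0// subr_gt0 gtr_pMr.
pose s := 1 - (1 - q) * k.
have s1 : s < 1 by rewrite /s ltrBlDr ltrDl mulr_gt0// subr_gt0.
have k1 : k <= 1.
  have : h * (h - h * h) <= 1 * 1.
    by apply: ler_pM; rewrite ?subr_ge0 ?ger_pMr ?ltW//; have := mulr_gt0 h0 h0; lra.
  by rewrite mulr1.
have s0 : 0 <= s.
  have : (1 - q) * k <= 1 * 1 by apply: ler_pM; lra.
  by rewrite /s; lra.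
(* The maximum with [2^-1] keeps [2 * g >= 1], on which the packing argument relies. *)
pose g := Num.max 2^-1 (s `^ p^-1).
have sg : s `^ p^-1 <= g by rewrite le_max lexx orbT.
have g2 : 2^-1 <= g by rewrite le_max lexx.
exists g.
  rewrite g2/= gt_max; apply/andP; split; first by lra.
  have : s `^ p^-1 < 1 `^ p^-1.
    by apply: gt0_ltr_powR; rewrite ?nnegrE ?invr_gt0.
  by rewrite powR1.
have unit_case n (a b : 'rV[R]_n) : lpnorm p a <= 1 -> lpnorm p b <= 1 ->
    2^-1 <= lpnorm p (a - b) -> lpnorm p (2^-1 *: (a + b)) <= g.
  move=> a1 b1 ab.
  rewrite lpnorm_leE//= ?powR1 in a1; rewrite lpnorm_leE//= ?powR1 in b1.
  have hab : h <= lpsum p (a - b).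
    by rewrite -lpnorm_powR// powR_le_mono// ?lpnorm_ge0.
  pose m j := (`|a ord0 j| `^ p + `|b ord0 j| `^ p) / 2.
  have m0 j : 0 <= m j by rewrite /m divr_ge0 ?addr_ge0 ?powR_ge0.
  have mab : \sum_j m j <= 1.
    rewrite /m -mulr_suml big_split/= -/(lpsum p a) -/(lpsum p b).
    by rewrite ler_pdivrMr// mul1r -[leRHS]/(1 + 1) lerD.
  pose P j := `|a ord0 j| + `|b ord0 j| <= 8 * `|a ord0 j - b ord0 j|.
  have dm j : `|a ord0 j - b ord0 j| `^ p <= m j / h /\
      (~~ P j -> `|a ord0 j - b ord0 j| `^ p <= h * h * m j).
    have e1 : ((`|a ord0 j| + `|b ord0 j|) / 2) `^ p <= m j by exact: powR_mid.
    have hV : h * 2 `^ p = 1 by rewrite /h -powRM// mulVf// powR1.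
    split.
      rewrite ler_pdivlMr// /h -powRM//.
      apply: le_trans e1; apply: ler_powRl => //.
      by rewrite ler_pM2r ?invr_gt0// ler_normB.
    rewrite /P -ltNge => lt8.
    (* Outside [P] the difference is below a quarter of the mean of the absolute values, and [h * h]
       is the [p]-th power of a quarter. *)
    apply: (@le_trans _ _ ((2^-1 * 2^-1 * ((`|a ord0 j| + `|b ord0 j|) / 2)) `^ p)).
      by apply: ler_powRl => //; lra.
    by rewrite powRM ?mulr_ge0// powRM// ler_pM2l// mulr_gt0.
  have hP : k <= \sum_(j | P j) m j.
    have : h <= (\sum_(j | P j) m j) / h + h * h.
      apply: le_trans hab _; rewrite /lpsum (bigID P)/=; apply: lerD.
        by rewrite mulr_suml; apply: ler_sum => j Pj; rewrite !mxE; have [] := dm j.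
      apply: (@le_trans _ _ (\sum_(j | ~~ P j) h * h * m j)).
        by apply: ler_sum => j Pj; rewrite !mxE; have [_ ->] := dm j.
      rewrite -mulr_sumr -[leRHS]mulr1 ler_pM2l ?mulr_gt0//.
      apply: le_trans mab; rewrite [leRHS](bigID P)/= lerDr.
      by apply: sumr_ge0.
    rewrite -lerBlDr ler_pdivlMr//; rewrite /k; lra.
  apply: le_trans sg.
  rewrite lpnorm_leE ?powR_ge0// -powRrM mulVf ?gt_eqF// powRr1//.
  apply: (@le_trans _ _ (\sum_j (m j - if P j then (1 - q) * m j else 0))).
    apply: ler_sum => j _; rewrite !mxE mulrC; case: ifPn => Pj.
      by apply: le_trans (hq _ _ Pj) _; rewrite -/(m j); lra.
    rewrite subr0; apply: le_trans (powR_mid p1' (normr_ge0 _) (normr_ge0 _)).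
    apply: ler_powRl => //; rewrite normrM (ger0_norm (_ : 0 <= 2^-1))//.
    by rewrite ler_pM2r ?invr_gt0// ler_normD.
  rewrite sumrB -big_mkcond/= -mulr_sumr /s.
  have : (1 - q) * k <= (1 - q) * \sum_(j | P j) m j by rewrite ler_pM2l// subr_gt0.
  lra.
move=> n a b r r0 ar br abr.
have scale (c : R) (x : 'rV[R]_n) : lpnorm p (r^-1 *: x) = lpnorm p x / r.
  by rewrite lpnormZ// ger0_norm ?invr_ge0 ?ltW// mulrC.
have := unit_case n (r^-1 *: a) (r^-1 *: b).
rewrite -scalerBr -scalerDr scalerA mulrC -scalerA !scale//.
move=> u; rewrite -(ler_pdivrMr _ _ r0); apply: u.
- by rewrite (ler_pdivrMr _ _ r0) mul1r; exact: ar.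
- by rewrite (ler_pdivrMr _ _ r0) mul1r; exact: br.
- by rewrite (ler_pdivlMr _ _ r0) mulrC; exact: abr.
Qed.

(** * Outer Lebesgue measure and grid points *)

Lemma nbhs_coord (R : realType) (n : nat) (x : 'rV[R]_n) (e : R) (P : set 'rV[R]_n) :
  0 < e -> (forall y : 'rV[R]_n, (forall j, `|x ord0 j - y ord0 j| < e) -> P y) -> nbhs x P.
Proof.
move=> e0 h; apply/nbhs_ballP; exists e => //= y xy; apply: h => j.
by have [_ /(_ ord0 j)] := xy.
Qed.

(** The ball is a closed subset of a cube; its complement is open because small changes of the
    coordinates change the l_p norm little. *)
Lemma lpball_compact (R : realType) (n : nat) (p : R) (x : 'rV[R]_n) (r : R) :
  1 <= p -> compact (lpball p x r).
Proof.
move=> p1.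
have bnd : compact [set v : 'rV[R]_n |
    forall i, `[x ord0 i - r, x ord0 i + r]%classic (v ord0 i)].
  apply: (@rV_compact _ _ (fun i => `[x ord0 i - r, x ord0 i + r]%classic)) => i.
  exact: segment_compact.
apply: subclosed_compact bnd _; last first.
  move=> v; rewrite /lpball/= => xv i; rewrite in_itv/=.
  have := le_trans (coord_le_lpnorm p1 (x - v) i) xv.
  by rewrite !mxE ler_norml => /andP[? ?]; apply/andP; split; lra.
have half (u v : R) : 0 < u -> v <= u / 2 -> v < u by lra.
have arith (u v w t : R) : u <= t -> t < v - r -> v <= w + u -> r < w by lra.
rewrite -[lpball p x r]setCK closedC openE => y; rewrite /interior/= => /negP.
rewrite -ltNge => ry.
(* The divisor [n.+1] is never zero, and the final halving makes the estimate strict. *)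
pose e := (lpnorm p (x - y) - r) / (n.+1)%:R / 2.
have e0 : 0 < e by rewrite /e !divr_gt0// subr_gt0.
apply: (nbhs_coord e0) => z yz; apply/negP; rewrite -ltNge.
have h1 : lpnorm p (y - z) <= n%:R * e.
  by apply: (lpnorm_le_bound p1 (ltW e0)) => j; rewrite !mxE ltW.
have h2 : n%:R * e < lpnorm p (x - y) - r.
  apply: half; first by rewrite subr_gt0.
  have -> : (lpnorm p (x - y) - r) / 2 = n.+1%:R * e by rewrite /e; field.
  by rewrite (ler_pM2r e0) ler_nat.
apply: (arith _ _ _ _ h1 h2); rewrite (lpnorm_distC p1 y z).
exact: lpnorm_triangle.
Qed.

Section OuterVolume.
Variables (R : realType) (n : nat).
Implicit Types (A B : set 'rV[R]_n) (a b : 'rV[R]_n).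

Lemma boxvol_ge0 a b : 0 <= boxvol a b.
Proof. by apply: prodr_ge0 => j _; rewrite le_max lexx orbT. Qed.

Lemma boxvol_series_ge0 (a b : nat -> 'rV[R]_n) :
  (0 <= \sum_(0 <= k <oo) (boxvol (a k) (b k))%:E)%E.
Proof. by apply: nneseries_ge0 => k _ _; rewrite lee_fin boxvol_ge0. Qed.

Lemma lvol_ge0 A : (0 <= lvol A)%E.
Proof. by apply: le_ereal_inf_tmp => _ [a [b [_ ->]]]; exact: boxvol_series_ge0. Qed.

Lemma lvol_mono A B : A `<=` B -> (lvol A <= lvol B)%E.
Proof.
move=> AB; apply: le_ereal_inf_tmp => s [a [b [Bab ->]]]; apply: ereal_inf_lbound.
by exists a, b; split => //; exact: subset_trans Bab.
Qed.

(** The finite family is padded to a sequence by boxes reduced to the origin, of volume 0 because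
    [0 < n]. *)
Lemma lvol_le_sum (T : eqType) (r : seq T) (a b : T -> 'rV[R]_n) A : (0 < n)%N ->
  (forall x, A x -> exists2 i, i \in r & box (a i) (b i) x) ->
  (lvol A <= (\sum_(i <- r) boxvol (a i) (b i))%:E)%E.
Proof.
move=> n0 Ar; apply: ereal_inf_lbound.
pose a' k := nth 0 [seq a i | i <- r] k; pose b' k := nth 0 [seq b i | i <- r] k.
exists a', b'; split.
  move=> x /Ar[i]; rewrite /a' /b'; elim: r {Ar a' b'} => [//|i0 r IH].
  rewrite inE => /predU1P[->|ir] abx.
    by exists 0%N.
  by have [k _ kx] := IH ir abx; exists k.+1.
have z k : (size r <= k)%N -> boxvol (a' k) (b' k) = 0.
  move=> rk; rewrite /a' /b' !nth_default ?size_map// /boxvol.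
  rewrite (bigD1 (Ordinal n0))//= !mxE subrr.
  by rewrite (_ : Num.max 0 0 = 0) ?mul0r//; apply/max_idPl.
rewrite (nneseries_split 0 (size r)); last by move=> k _; rewrite lee_fin boxvol_ge0.
rewrite [X in (_ + X)%E]eseries0 ?adde0; last first.
  by move=> k rk _; rewrite z.
rewrite sumEFin add0n; congr (_%:E).
rewrite /a' /b' {z a' b' Ar}.
elim: r => [|i r IH]; first by rewrite big_nil big_geq.
by rewrite big_cons big_nat_recl//= IH.
Qed.

(** Pull each cover of [B] back along the affine map: boxes become boxes, with volume divided by
    [c ^+ n]. *)
Lemma lvol_affine (c : R) (x : 'rV[R]_n) A B : 0 < c ->
  (forall y, A y -> B (x + c *: y)) ->
  (lvol A <= ((c ^+ n)^-1)%:E * lvol B)%E.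
Proof.
move=> c0 AB; have cn0 : 0 < c ^+ n by rewrite exprn_gt0.
rewrite lee_pdivlMl//; apply: le_ereal_inf_tmp => s [a [b [Bab ->]]].
rewrite -lee_pdivlMl//; apply: ereal_inf_lbound.
exists (fun k => c^-1 *: (a k - x)), (fun k => c^-1 *: (b k - x)); split.
  move=> y /AB /Bab [k _ kx]; exists k => // j; move: (kx j); rewrite !mxE.
  rewrite ![c^-1 * _]mulrC ler_pdivrMr// ler_pdivlMr// => /andP[? ?].
  by apply/andP; split; lra.
rewrite -nneseriesZl; last by move=> k _; rewrite lee_fin boxvol_ge0.
apply: eq_eseriesr => k _; rewrite -EFinM; congr (_%:E).
rewrite /boxvol -exprVn -[X in _ ^+ X]card_ord -prodr_const -big_split/=.
apply: eq_bigr => j _; rewrite !mxE maxr_pMr ?invr_ge0 ?ltW// mulr0.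
by congr Num.max; lra.
Qed.

End OuterVolume.

(** * Counting grid points in boxes and compact sets *)

Lemma card_le_sum (T I : finType) (S : {set T}) (F : I -> {set T}) :
  (forall x, x \in S -> exists i, x \in F i) -> (#|S| <= \sum_i #|F i|)%N.
Proof.
move=> SF; under [leqRHS]eq_bigr do rewrite -sum1_card.
rewrite (exchange_big_dep predT)//= -sum1_card [leqRHS](bigID (mem S))/=.
apply: (leq_trans _ (leq_addr _ _)); apply: leq_sum => x /SF[i xi].
by rewrite (bigD1 i).
Qed.

Section GridCount.
Variables (R : realType) (n : nat).

Definition grid (m : nat) (s : 'rV[R]_n) (h : R) (f : {ffun 'I_n -> 'I_m}) : 'rV[R]_n :=
  \row_j (s ord0 j + h * (f j)%:R).

(** The smallest and largest admissible indices differ by at most [(b - a) / h]. *)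
Lemma card_ord_itv (m : nat) (h s a b : R) : 0 < h ->
  #|[pred i : 'I_m | a <= s + h * i%:R <= b]|%:R <= Num.max (b - a) 0 / h + 1.
Proof.
move=> h0; set P := [pred i | _].
have [/eqP ->|/pred0Pn[i0' Pi0']] := boolP (#|P| == 0%N).
  by rewrite addr_ge0// divr_ge0 ?(ltW h0)// le_max lexx orbT.
have [i0 Pi0 mi0] := arg_minnP (fun i : 'I_m => i : nat) Pi0'.
have [i1 Pi1 mi1] := arg_maxnP (fun i : 'I_m => i : nat) Pi0'.
have i01 : (i0 <= i1)%N by exact: mi1.
have hc : (#|P| <= (i1 - i0).+1)%N.
  rewrite cardE -(size_map val) -(size_iota i0 (i1 - i0).+1); apply: uniq_leq_size.
    by rewrite map_inj_uniq ?enum_uniq//; exact: val_inj.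
  move=> _ /mapP[i + ->]; rewrite mem_enum mem_iota => Pi.
  by rewrite mi0//= addnS ltnS subnKC//; exact: mi1.
apply: (@le_trans _ _ ((i1 - i0)%:R + 1)).
  by rewrite natr1 ler_nat.
rewrite lerD2r ler_pdivlMr// le_max natrB//; apply/orP; left.
move: Pi0 Pi1; rewrite !inE => /andP[? ?] /andP[? ?]; lra.
Qed.

Lemma card_grid_box (m : nat) (s a b : 'rV[R]_n) (h : R) : 0 < h ->
  #|[set f : {ffun 'I_n -> 'I_m} |
    [forall j, a ord0 j <= grid s h f ord0 j <= b ord0 j]]%SET|%:R
    * h ^+ n <= \prod_(j < n) (Num.max (b ord0 j - a ord0 j) 0 + h).
Proof.
move=> h0.
pose F (j : 'I_n) := [pred i : 'I_m | a ord0 j <= s ord0 j + h * i%:R <= b ord0 j].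
have -> : #|[set f : {ffun 'I_n -> 'I_m} |
    [forall j, a ord0 j <= grid s h f ord0 j <= b ord0 j]]%SET|
    = (\prod_(j < n) #|F j|)%N.
  rewrite (eq_card (B := family F)); last first.
    move=> f; rewrite finset.in_set; apply/forallP/familyP => H j; move: (H j);
      by rewrite /F !inE !mxE.
  by rewrite card_family foldrE big_map -big_enum.
rewrite natr_prod -[X in _ ^+ X]card_ord -prodr_const -big_split/=.
apply: ler_prod => j _; rewrite mulr_ge0 ?(ltW h0)//=.
rewrite -ler_pdivlMr// mulrDl divff ?gt_eqF//.
exact: card_ord_itv.
Qed.

Lemma prod_inflate (r : seq 'I_n) (c : 'I_n -> R) : (forall j, 0 <= c j) ->
  exists2 C : R, 0 <= C & forall t, 0 <= t <= 1 ->
    \prod_(j <- r) (c j + 3 * t) <= \prod_(j <- r) c j + C * t.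
Proof.
move=> c0; elim: r => [|i r [C C0 IH]].
  by exists 0 => // t _; rewrite !big_nil mul0r addr0.
set P := \prod_(j <- r) c j in IH *.
have P0 : 0 <= P by apply: prodr_ge0.
exists (c i * C + 3 * (P + C)).
  by have := c0 i; have := mulr_ge0 (c0 i) C0; lra.
move=> t /andP[t0 t1]; rewrite !big_cons -/P.
apply: (@le_trans _ _ ((c i + 3 * t) * (P + C * t))).
  by rewrite ler_wpM2l ?IH ?t0// addr_ge0// mulr_ge0.
have : t * (C * t) <= 1 * (C * t) by rewrite ler_wpM2r// mulr_ge0.
lra.
Qed.

(** In [3 * t], two parts pay for moving both ends of a side outwards by [t], and one for a mesh
    [h <= t] in [card_grid_box]. *)
Lemma boxvol_inflate (a b : 'rV[R]_n) (e : R) : 0 < e -> exists t : R, 0 < t /\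
  \prod_(j < n) (Num.max (b ord0 j - a ord0 j) 0 + 3 * t) <= boxvol a b + e.
Proof.
move=> e0.
have [C C0 hC] := @prod_inflate (index_enum 'I_n)
  (fun j => Num.max (b ord0 j - a ord0 j) 0) (fun j => ltac:(by rewrite le_max lexx orbT)).
pose t := Num.min 1 (e / (C + 1)).
have C1 : 0 < C + 1 by lra.
have t0 : 0 < t by rewrite lt_min ltr01 divr_gt0.
exists t; split => //; apply: (le_trans (hC t _)).
  by rewrite ltW//= ge_min lexx.
rewrite /boxvol lerD2l.
have : t <= e / (C + 1) by rewrite ge_min lexx orbT.
rewrite ler_pdivlMr//; nra.
Qed.

(* A cover by boxes is enlarged to an open one, reduced to a finite subcover by
   compactness, and the grid points of each box are counted. *)
Lemma grid_count_le_lvol (K : set 'rV[R]_n) (C e : R) :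
  compact K -> (lvol K <= C%:E)%E -> 0 < e ->
  exists2 h0 : R, 0 < h0 & forall h m s (S : {set {ffun 'I_n -> 'I_m}}),
    0 < h -> h <= h0 -> (forall f, f \in S -> K (grid s h f)) ->
    #|S|%:R * h ^+ n <= C + e.
Proof.
move=> cK KC e0.
have : (lvol K < (C + e / 2)%:E)%E.
  by apply: le_lt_trans KC _; rewrite lte_fin; lra.
move=> /ereal_inf_lt[_ [a [b [Kab ->]]] sC].
(* The [k]-th box may grow by this amount; the total stays below [e / 2]. *)
have ek0 k : 0 < e / 2 * 2^-1 ^+ k.+1 by rewrite mulr_gt0 ?exprn_gt0// divr_gt0.
have [t ht] := choice (fun k => boxvol_inflate (a k) (b k) (ek0 k)).
pose a' k : 'rV[R]_n := \row_j (a k ord0 j - t k).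
pose b' k : 'rV[R]_n := \row_j (b k ord0 j + t k).
have := cK; rewrite compact_cover => /(_ nat setT (fun k => (box (a' k) (b' k))°)).
case.
- by move=> k _; exact: open_interior.
- move=> x /Kab[k _ kx]; exists k => //; have [tk0 _] := ht k.
  apply: (nbhs_coord tk0) => y xy j; move: (kx j) (xy j).
  rewrite !mxE ltr_norml => /andP[? ?] /andP[? ?]; apply/andP; split; lra.
move=> D _ KD.
pose N := (\max_(k <- finmap.enum_fset D) k).+1.
have KN x : K x -> exists2 k, (k < N)%N & box (a' k) (b' k) x.
  move=> /KD[k kD /interior_subset kx]; exists k => //.
  by rewrite ltnS (@leq_bigmax_seq _ (finmap.enum_fset D) xpredT (fun k => k)).
(* The finite subcover leaves a single mesh bound below all margins; it does not depend on the
   origin [s] of the grid. *)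
have [h0 h00 hh0] : exists2 h0 : R, 0 < h0 & forall k, (k < N)%N -> h0 <= t k.
  elim: (N) => [|N' [h1 h10 IH]]; first by exists 1.
  exists (Num.min h1 (t N')); first by rewrite lt_min h10; have [] := ht N'.
  move=> k; rewrite ltnS leq_eqVlt => /orP[/eqP ->|kN]; first by rewrite ge_min lexx orbT.
  by rewrite ge_min IH.
exists h0 => // h m s S h_gt0 hh SK.
pose Sk k := [set f : {ffun 'I_n -> 'I_m} |
   [forall j, a' k ord0 j <= grid s h f ord0 j <= b' k ord0 j]]%SET.
have cS : (#|S| <= \sum_(0 <= k < N) #|Sk k|)%N.
  rewrite big_mkord; apply: card_le_sum => f /SK /KN[k kN kf].
  by exists (Ordinal kN); rewrite inE; apply/forallP.
apply: (@le_trans _ _ (\sum_(0 <= k < N) (boxvol (a k) (b k) + e / 2 * 2^-1 ^+ k.+1))).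
  apply: (@le_trans _ _ (\sum_(0 <= k < N) #|Sk k|%:R * h ^+ n)).
    by rewrite -mulr_suml -natr_sum ler_wpM2r ?ler_nat// exprn_ge0// ltW.
  apply: ler_sum_nat => k /andP[_ kN].
  apply: le_trans (card_grid_box _ _ _ _ h_gt0) _.
  have [tk0 tk] := ht k; apply: le_trans tk; apply: ler_prod => j _.
  rewrite !mxE addr_ge0 ?(ltW h_gt0) ?le_max ?lexx ?orbT//=.
  have := le_trans hh (hh0 k kN).
  have : Num.max (b k ord0 j + t k - (a k ord0 j - t k)) 0 <=
         Num.max (b k ord0 j - a k ord0 j) 0 + 2 * t k.
    rewrite ge_max; apply/andP; split.
      have : b k ord0 j - a k ord0 j <= Num.max (b k ord0 j - a k ord0 j) 0.
        by rewrite le_max lexx.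
      lra.
    by rewrite addr_ge0 ?mulr_ge0 ?(ltW tk0)// le_max lexx orbT.
  lra.
rewrite big_split/= -mulr_sumr.
have g : \sum_(0 <= k < N) 2^-1 ^+ k.+1 <= (1 : R).
  suff -> : \sum_(0 <= k < N) 2^-1 ^+ k.+1 = 1 - 2^-1 ^+ N :> R.
    by rewrite gerBl exprn_ge0.
  elim: (N) => [|N' IH]; first by rewrite big_geq// expr0 subrr.
  by rewrite big_nat_recr//= IH exprS; lra.
have u : \sum_(0 <= k < N) boxvol (a k) (b k) <= C + e / 2.
  rewrite -lee_fin; apply: le_trans (ltW sC); rewrite -sumEFin.
  by apply: nneseries_lim_ge => k _ _; rewrite lee_fin boxvol_ge0.
have : e / 2 * \sum_(0 <= k < N) 2^-1 ^+ k.+1 <= e / 2 * 1.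
  by rewrite ler_wpM2l// divr_ge0// ltW.
lra.
Qed.

End GridCount.

(** * Volumes of l_p balls *)

Section BallVolume.
Variables (R : realType) (p : R) (n : nat).
Hypothesis p1 : 1 <= p.
Hypothesis n0 : (0 < n)%N.

Lemma lvol_lpball_scale (x y : 'rV[R]_n) (c r : R) : 0 < c ->
  (lvol (lpball p x (c * r)) <= (c ^+ n)%:E * lvol (lpball p y r))%E.
Proof.
move=> c0; have cV : 0 < c^-1 by rewrite invr_gt0.
have := @lvol_affine R n c^-1 (y - c^-1 *: x) (lpball p x (c * r)) (lpball p y r) cV.
rewrite exprVn invrK; apply => z; rewrite /lpball/=.
have -> : y - (y - c^-1 *: x + c^-1 *: z) = c^-1 *: (x - z).
  by rewrite scalerBr opprD addrA opprB addrCA subrr addr0.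
move=> xz; rewrite lpnormZ// ger0_norm ?(ltW cV)// [leLHS]mulrC.
by rewrite (ler_pdivrMr _ _ c0) [leRHS]mulrC.
Qed.

Lemma lvol_unit_lpball_le : (lvol (lpball p (0 : 'rV[R]_n) 1) <= (2 ^+ n)%:E)%E.
Proof.
have := @lvol_le_sum R n bool [:: true] (fun=> const_mx (-1)) (fun=> const_mx 1)
  (lpball p (0 : 'rV[R]_n) 1) n0.
rewrite big_seq1.
have -> : boxvol (const_mx (-1)) (const_mx 1 : 'rV[R]_n) = 2 ^+ n.
  rewrite /boxvol -[X in _ ^+ X]card_ord -prodr_const; apply: eq_bigr => j _.
  by rewrite !mxE opprK; apply/max_idPl.
apply => x; rewrite /lpball/= sub0r lpnormN// => x1.
exists true => // j; rewrite !mxE -ler_norml.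
exact: le_trans (coord_le_lpnorm p1 x j) x1.
Qed.

(** The ball contains the cube of side [1/n] with a corner at the origin. A grid of mesh [1/(n m)]
    has [m ^ n] points there, which exceeds what [grid_count_le_lvol] would allow for volume 0. *)
Lemma lvol_unit_lpball_gt0 : (0 < lvol (lpball p (0 : 'rV[R]_n) 1))%E.
Proof.
rewrite ltNge; apply/negP => v0.
have nR : 0 < n%:R :> R by rewrite ltr0n.
pose e : R := n%:R^-1 ^+ n / 2.
have e0 : 0 < e by rewrite divr_gt0// exprn_gt0// invr_gt0.
have [h0 h00 H] := grid_count_le_lvol (lpball_compact p1) v0 e0.
pose m := (Num.truncn (n%:R * h0)^-1).+1.
have mh : (n%:R * h0)^-1 < m%:R by rewrite /m truncnS_gt.
have m0 : 0 < m%:R :> R by rewrite ltr0n.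
pose h : R := (n%:R * m%:R)^-1.
have h_gt0 : 0 < h by rewrite invr_gt0 mulr_gt0.
have hh : h <= h0.
  rewrite /h -[leRHS]invrK lef_pV2 ?posrE ?mulr_gt0 ?invr_gt0//.
  by move: mh; rewrite invfM ltr_pdivrMl// => /ltW.
have := H h m 0 [set: {ffun 'I_n -> 'I_m}]%SET h_gt0 hh.
rewrite cardsT card_ffun !card_ord natrX -exprMn.
have -> : m%:R * h = n%:R^-1 :> R by rewrite /h; field; rewrite !gt_eqF.
rewrite add0r => h1; suff : n%:R^-1 ^+ n <= e by rewrite /e; move: e0; rewrite /e; lra.
apply: h1 => f _; rewrite /lpball/= sub0r lpnormN//.
have -> : 1 = n%:R * n%:R^-1 :> R by rewrite divff ?gt_eqF.
apply: lpnorm_le_bound => //.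
move=> j; rewrite !mxE add0r ger0_norm ?mulr_ge0 ?(ltW h_gt0)//.
have -> : n%:R^-1 = h * m%:R by rewrite /h; field; rewrite !gt_eqF.
by rewrite ler_pM2l// ler_nat ltnW.
Qed.

(** [lvol_lpball_scale] is used with [c] and, for the reverse inequality, with [c^-1]. *)
Lemma lvol_lpballE (r : R) : lvol (lpball p (0 : 'rV[R]_n) r) = 1%E ->
  forall (x : 'rV[R]_n) (c : R), 0 < c -> lvol (lpball p x (c * r)) = (c ^+ n)%:E.
Proof.
move=> r1 x c c0; have cn : 0 < c ^+ n by rewrite exprn_gt0.
apply/eqP; rewrite eq_le; apply/andP; split.
  by have := lvol_lpball_scale x 0 r c0; rewrite r1 mule1.
have cV : 0 < c^-1 by rewrite invr_gt0.
have := lvol_lpball_scale 0 x (c * r) cV.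
by rewrite mulKf ?gt_eqF// r1 exprVn lee_pdivlMl// mule1.
Qed.

Lemma exists_unit_radius :
  exists2 r : R, 0 < r & lvol (lpball p (0 : 'rV[R]_n) r) = 1%E.
Proof.
have := lvol_unit_lpball_le; have := lvol_unit_lpball_gt0.
move Ev : (lvol _) => V; case: V Ev => [v|//|//] Ev v0 _.
rewrite lte_fin in v0.
have nR : 0 < n%:R :> R by rewrite ltr0n.
(* Scaling the unit ball by [r] multiplies its volume [v] by [r ^+ n = v^-1]. *)
pose r := v `^ (- n%:R^-1).
have r0 : 0 < r by exact: powR_gt0.
have rn : r ^+ n = v^-1.
  rewrite -powR_mulrn ?(ltW r0)// /r -powRrM mulNr mulVf ?gt_eqF//.
  by rewrite powR_inv1 ?ltW.
exists r => //; apply/eqP; rewrite eq_le; apply/andP; split.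
  have := lvol_lpball_scale 0 0 1 r0.
  by rewrite mulr1 Ev rn -EFinM mulVf ?gt_eqF.
have rV : 0 < r^-1 by rewrite invr_gt0.
have := lvol_lpball_scale 0 0 r rV.
rewrite mulVf ?gt_eqF// Ev exprVn rn invrK -lee_pdivrMl//.
by rewrite -EFinM mulVf ?gt_eqF.
Qed.

(** Rounding every coordinate down to the grid covers the ball by cells of side [h], whose corners
    are within [n * h] of the ball. *)
Lemma lvol_lpball_le_count (x s : 'rV[R]_n) (r h : R) (m : nat) : 0 < h ->
  (forall y, lpball p x r y -> forall j, s ord0 j <= y ord0 j < s ord0 j + h * m%:R) ->
  (lvol (lpball p x r) <=
   (#|[set f : {ffun 'I_n -> 'I_m} | lpnorm p (x - grid s h f) <= r + n%:R * h]%SET|%:R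
      * h ^+ n)%:E)%E.
Proof.
move=> h0 hs; set S := [set f | _]%SET.
have := @lvol_le_sum R n _ (enum S) (grid s h) (fun f => grid s h f + const_mx h)
  (lpball p x r) n0.
have -> : \sum_(f <- enum S) boxvol (grid s h f) (grid s h f + const_mx h) =
    #|S|%:R * h ^+ n.
  rewrite (eq_bigr (fun=> h ^+ n)); last first.
    move=> f _; rewrite /boxvol -[X in _ ^+ X]card_ord -prodr_const.
    apply: eq_bigr => j _; rewrite !mxE addrAC subrr add0r.
    by apply/max_idPl; exact: ltW.
  by rewrite big_const_seq count_predT iter_addr_0 -cardE mulr_natl.
apply => y xy.
have ge0 j : 0 <= (y ord0 j - s ord0 j) / h.
  by have /andP[? _] := hs y xy j; rewrite divr_ge0 ?subr_ge0 ?(ltW h0).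
have ltm j : (Num.truncn ((y ord0 j - s ord0 j) / h) < m)%N.
  have /andP[_ lt] := hs y xy j.
  by rewrite truncn_lt_nat// ltr_pdivrMr// ltrBlDl mulrC.
pose f := [ffun j => Ordinal (ltm j)].
have near j : grid s h f ord0 j <= y ord0 j <= grid s h f ord0 j + h.
  rewrite !mxE ffunE/=; have /andP[le lt] := truncn_itv (ge0 j).
  move: le lt; rewrite -natr1 ler_pdivlMr// ltr_pdivrMr// => le lt.
  by apply/andP; split; lra.
exists f; last first.
  by move=> j; have := near j; rewrite !mxE.
rewrite mem_enum inE; apply: le_trans (lpnorm_triangle p1 x y _) _.
apply: lerD; first exact: xy.
apply: lpnorm_le_bound => //; first exact: (ltW h0).
move=> j; have := near j; rewrite !mxE => /andP[? ?].
by rewrite ger0_norm; lra.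
Qed.

End BallVolume.

(** * Volume of a union of disjoint balls *)

Lemma bernoulli_le (R : realType) (y : R) (n : nat) : 0 <= y <= 1 ->
  1 - n%:R * y <= (1 - y) ^+ n.
Proof.
move=> /andP[y0 y1]; elim: n => [|n IH]; first by rewrite mul0r subr0 expr0.
rewrite exprS -natr1.
have : (1 - y) * (1 - n%:R * y) <= (1 - y) * (1 - y) ^+ n.
  by rewrite ler_wpM2l// subr_ge0.
have : 0 <= n%:R * y * y by rewrite !mulr_ge0.
lra.
Qed.

Lemma exists_grid_size (R : realType) (L h : R) : 0 < h ->
  exists m : nat, L < h * m%:R.
Proof.
move=> h0; exists (Num.truncn (L / h)).+1.
by rewrite -ltr_pdivrMl// mulrC truncnS_gt.
Qed.

Lemma card_bigcup_disjoint (T I : finType) (A : {set I}) (F : I -> {set T}) :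
  (forall i j x, i \in A -> j \in A -> x \in F i -> x \in F j -> i = j) ->
  #|(\bigcup_(i in A) F i)%SET| = (\sum_(i in A) #|F i|)%N.
Proof.
move=> dF.
have -> : (\bigcup_(i in A) F i =
    \bigcup_i (if i \in A then F i else finset.set0))%SET by rewrite big_mkcond.
rewrite -sum1_card partition_disjoint_bigcup.
  rewrite [RHS]big_mkcond/=; apply: eq_bigr => i _.
  by case: ifP; rewrite sum1_card ?cards0.
move=> i j ij; rewrite -setI_eq0; apply/eqP/setP => x; rewrite !finset.inE.
case: ifP => iA; last by rewrite finset.inE.
case: ifP => jA; last by rewrite finset.inE andbF.
by apply/negP => /andP[xi xj]; rewrite (dF i j x) ?eqxx in ij.
Qed.

Section UnionVolume.
Variables (R : realType) (p : R) (n : nat) (r T : R).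
Hypothesis p1 : 1 <= p.
Hypothesis n0 : (0 < n)%N.
Hypothesis r0 : 0 < r.
Hypothesis r1 : lvol (lpball p (0 : 'rV[R]_n) r) = 1%E.

Lemma lpball_in_grid (m : nat) (h : R) : 2 * T < h * m%:R ->
  forall y : 'rV[R]_n, lpnorm p y <= T ->
  forall j, (const_mx (- T) : 'rV[R]_n) ord0 j <= y ord0 j
     < (const_mx (- T) : 'rV[R]_n) ord0 j + h * m%:R.
Proof.
move=> hm y yT j; rewrite mxE.
have := le_trans (coord_le_lpnorm p1 y j) yT; rewrite ler_norml => /andP[yl yu].
by move: (y ord0 j) (h * m%:R) hm yl yu => u v *; apply/andP; split; lra.
Qed.

(** Grid points replace additivity: each ball contains at least [3/4 * h ^- n] of them, the balls
    are disjoint, and the compact union [K] of volume [C] contains at most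
    [(C + #|I| / 4) * h ^- n]. *)
Lemma lvol_union_ge (J : finType) (I : {set J}) (c : J -> 'rV[R]_n) :
  (forall i, i \in I -> lpnorm p (c i) <= T - r) ->
  (forall i j, i \in I -> j \in I -> i != j -> 2 * r < lpnorm p (c i - c j)) ->
  ((#|I|%:R / 2)%:E <= lvol (lpball p (0 : 'rV[R]_n) T `&`
     \bigcup_(x in [set c i | i in [set` I]]) lpball p x r))%E.
Proof.
move=> cT csep.
have nR : 0 < n%:R :> R by rewrite ltr0n.
have [->|/set0Pn[i0 i0I]] := eqVneq I finset.set0.
  by rewrite cards0 mul0r; exact: lvol_ge0.
have I0 : 0 < #|I|%:R :> R by rewrite ltr0n; apply/card_gt0P; exists i0.
have T0 : 0 < T.
  have := le_trans (lpnorm_ge0 p (c i0)) (cT _ i0I); rewrite subr_ge0.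
  exact: lt_le_trans r0.
have inT i x : i \in I -> lpball p (c i) r x -> lpnorm p x <= T.
  move=> iI xr; have h1 := lpnorm_triangle p1 x (c i) 0.
  rewrite !subr0 in h1; apply: (le_trans h1).
  rewrite -[leRHS](subrKC r); apply: lerD; last exact: cT.
  by rewrite lpnorm_distC.
have csep' i j x : i \in I -> j \in I ->
    lpnorm p (c i - x) <= r -> lpnorm p (c j - x) <= r -> i = j.
  move=> iI jI xi xj; apply/eqP; apply: contraT => ij.
  have := csep i j iI jI ij; rewrite ltNge mulr_natl mulr2n => /negP h; exfalso; apply: h.
  apply: (le_trans (lpnorm_triangle p1 _ x _)); apply: lerD; first exact: xi.
  by rewrite lpnorm_distC.
pose K := \big[setU/set0]_(i <- enum I) lpball p (c i) r.
have KE x : K x <-> exists2 i, i \in I & lpball p (c i) r x.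
  rewrite /K -bigcup_seq; split => [[i /=]|[i iI xr]].
    by rewrite mem_enum => iI xr; exists i.
  by exists i => //=; rewrite mem_enum.
have cK : compact K by apply: bigsetU_compact => i _; exact: lpball_compact.
have KT : K `<=` lpball p (0 : 'rV[R]_n) T.
  by move=> x /KE[i iI xr]; rewrite /lpball/= sub0r lpnormN//; exact: inT xr.
apply: (@le_trans _ _ (lvol K)); last first.
  apply: lvol_mono => x Kx; split; first exact: KT.
  by have /KE[i iI xr] := Kx; exists (c i) => //; exists i.
have := lvol_mono KT; have := lvol_ge0 K.
rewrite -[T in lpball _ _ T](divfK (lt0r_neq0 r0)) (lvol_lpballE p1 r1) ?divr_gt0//.
move EC : (lvol K) => V; case: V EC => [C|//|//] EC C0 _.
rewrite lee_fin.
have KC : (lvol K <= C%:E)%E by rewrite EC.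
have e0 : 0 < #|I|%:R / 4 :> R by rewrite divr_gt0.
have [h0 h00 H] := grid_count_le_lvol cK KC e0.
(* Shrinking a ball from radius [r] to [r - n * h] then loses at most a quarter of its volume, by
   Bernoulli. *)
pose h := Num.min h0 (r / (4 * n%:R * n%:R)).
have h_gt0 : 0 < h by rewrite lt_min h00 divr_gt0// !mulr_gt0.
have hh0 : h <= h0 by rewrite ge_min lexx.
have hr : n%:R * (n%:R * h / r) <= 4^-1.
  have : h <= r / (4 * n%:R * n%:R) by rewrite ge_min lexx orbT.
  rewrite ler_pdivlMr ?mulr_gt0// => hr.
  have -> : n%:R * (n%:R * h / r) = (h * (4 * n%:R * n%:R)) / r / 4.
    by field; rewrite gt_eqF.
  by rewrite -[leRHS]mul1r ler_pM2r ?invr_gt0// ler_pdivrMr// mul1r.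
have hr1 : n%:R * h / r <= 4^-1.
  apply: le_trans hr; rewrite ler_peMl ?ler1n//.
  by rewrite divr_ge0 ?mulr_ge0 ?(ltW r0) ?(ltW h_gt0).
have hr0 : 0 <= n%:R * h / r.
  by rewrite divr_ge0 ?mulr_ge0 ?(ltW r0) ?(ltW h_gt0).
have [m hm] := exists_grid_size (2 * T) h_gt0.
pose s : 'rV[R]_n := const_mx (- T).
pose S i := [set f : {ffun 'I_n -> 'I_m} | lpnorm p (c i - grid s h f) <= r]%SET.
have SP i f : f \in S i -> lpnorm p (c i - grid s h f) <= r.
  by rewrite finset.in_set.
have cS i : i \in I -> 3 / 4 <= #|S i|%:R * h ^+ n.
  move=> iI; have := @lvol_lpball_le_count R p n p1 n0 (c i) s
    ((1 - n%:R * h / r) * r) h m h_gt0.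
  have -> : (1 - n%:R * h / r) * r + n%:R * h = r by field; rewrite gt_eqF.
  rewrite (lvol_lpballE p1 r1); last by lra.
  rewrite lee_fin => cnt; apply: le_trans (cnt _); last first.
    move=> y yr; apply: lpball_in_grid => //; apply: (inT i) => //.
    apply: le_trans yr _; rewrite ger_pMl// gerBl//.
  have y01 : 0 <= n%:R * h / r <= 1 by rewrite hr0/=; lra.
  apply: le_trans (bernoulli_le n y01).
  by move: (n%:R * (n%:R * h / r)) hr => u; lra.
have := H h m s (\bigcup_(i in I) S i)%SET h_gt0 hh0.
have dS i j f : i \in I -> j \in I -> f \in S i -> f \in S j -> i = j.
  by move=> iI jI /SP fi /SP fj; exact: csep' iI jI fi fj.
rewrite (card_bigcup_disjoint dS).
move=> hC; have : 3 / 4 * #|I|%:R <= C + #|I|%:R / 4.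
  apply: le_trans (hC _); last first.
    move=> f /bigcupP[i iI]; move=> /SP fi; apply/KE.
    by exists i; [exact: iI|exact: fi].
  rewrite natr_sum mulr_suml mulr_natr -sumr_const; apply: ler_sum => i iI.
  exact: cS.
lra.
Qed.

End UnionVolume.

(** * Packings *)

(* Two points at distance in [(r, 2r]] have few common neighbours: by uniform
   convexity these all lie within [2 g r] of their midpoint. *)
Lemma separated_subset (R : realType) (p g r d D : R) (n : nat) (V : finType)
    (pt : V -> 'rV[R]_n) :
  1 <= p -> 2^-1 <= g -> 0 < r ->
  (forall a b : 'rV[R]_n, lpnorm p a <= 2 * r -> lpnorm p b <= 2 * r ->
     2 * r / 2 <= lpnorm p (a - b) -> lpnorm p (2^-1 *: (a + b)) <= g * (2 * r)) ->
  (forall (S : {set V}) (x : 'rV[R]_n),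
     (forall v, v \in S -> lpnorm p (pt v - x) <= 2 * r) -> #|S|%:R <= d) ->
  (forall (S : {set V}) (x : 'rV[R]_n),
     (forall v, v \in S -> lpnorm p (pt v - x) <= g * (2 * r)) -> #|S|%:R <= D) ->
  1 <= D -> 2 * D <= d ->
  exists2 I : {set V},
    forall i j, i \in I -> j \in I -> i != j -> 2 * r < lpnorm p (pt i - pt j) &
    #|V|%:R * ln (d / (2 * D)) / (32 * d) <= #|I|%:R.
Proof.
move=> p1 g2 r0 uc hd hD D1 Dd.
pose e : rel V := fun u v => (u != v) && (lpnorm p (pt u - pt v) <= 2 * r).
pose A v := [set u | lpnorm p (pt u - pt v) <= r]%SET.
have eP u v : e u v -> lpnorm p (pt u - pt v) <= 2 * r by case/andP.
have AP v u : u \in A v -> lpnorm p (pt u - pt v) <= r by rewrite finset.in_set.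
have ANP v u : u \notin A v -> r <= lpnorm p (pt u - pt v).
  by rewrite finset.in_set -ltNge => /ltW.
have nP v u : u \in nbr e v -> e v u by rewrite finset.in_set.
have e_sym : symmetric e by move=> u v; rewrite /e eq_sym lpnorm_distC.
have e_irr : irreflexive e by move=> u; rewrite /e eqxx.
(* This puts the points of [A v], those within [r] of [v], under the bound [D]. *)
have gr : r <= g * (2 * r).
  have : 2^-1 * (2 * r) <= g * (2 * r) by rewrite ler_pM2r// mulr_gt0.
  by lra.
have D0 : 0 < 2 * D by lra.
(* The fugacity [(2 * D)^-1] is the largest with [D * l <= 2^-1]. *)
have [|||||||I sI hI] := @large_stable_set R V e A D d (2 * D)^-1 e_sym e_irr.
- move=> v; apply: (hd _ (pt v)) => u /nP; rewrite e_sym; exact: eP.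
- by move=> v; apply: (hD _ (pt v)) => u /AP ur; exact: le_trans gr.
- move=> v u /finset.setDP[/nP evu /ANP ruv].
  (* For a common neighbour [w], apply convexity to [w - v] and [w - u], whose difference is
     [u - v], of norm at least [r]. *)
  apply: (hD _ (2^-1 *: (pt u + pt v))) => w /finset.setIP[/nP euw /nP evw].
  have -> : pt w - 2^-1 *: (pt u + pt v) =
      2^-1 *: ((pt w - pt v) + (pt w - pt u)).
    by apply/rowP => j; rewrite !mxE; lra.
  apply: uc.
  + by apply: eP; rewrite e_sym.
  + by apply: eP; rewrite e_sym.
  + have -> : pt w - pt v - (pt w - pt u) = pt u - pt v.
      by apply/rowP => j; rewrite !mxE; lra.
    by rewrite mulrC mulKf.
- by rewrite invr_gt0.
- by rewrite invf_le1//; lra.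
- by rewrite invfM mulrCA divff ?mulr1// gt_eqF//; lra.
- by rewrite ler_pdivlMr// mul1r.
exists I => // i j iI jI ij; rewrite ltNge; apply/negP => h.
by move/stableP : sI => /(_ i j iI jI) /negP; apply; apply/andP.
Qed.

(** The constant 512 collects factors 2 for the grid points lost near the boundary, 2 for [ln 2] in
    the logarithm, 64 for [32 * d * h ^+ n = 64 * 2 ^+ n], and 2 for the volume of the union. *)
Lemma dense_packing (R : realType) (p g r T : R) (n : nat) :
  1 < p -> (0 < n)%N -> 2^-1 <= g < 1 ->
  (forall (a b : 'rV[R]_n) (r : R), 0 < r ->
    lpnorm p a <= r -> lpnorm p b <= r -> r / 2 <= lpnorm p (a - b) ->
    lpnorm p (2^-1 *: (a + b)) <= g * r) ->
  0 < r -> lvol (lpball p (0 : 'rV[R]_n) r) = 1%E ->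
  4 * n%:R * r <= T -> ln 2 <= - ln g * n%:R / 2 ->
  exists2 P : set 'rV[R]_n, is_packing p r P &
    - ln g / 512 * n%:R / 2 ^+ n <= cover_ratio p r T P.
Proof.
move=> p1' n0 /andP[g2 g1] uc r0 r1 hT hn.
have p1 := ltW p1'; have g0 : 0 < g by lra.
have nR1 : 1 <= n%:R :> R by rewrite ler1n.
have nR : 0 < n%:R :> R by lra.
have nr : r <= n%:R * r by rewrite ler_peMl// ltW.
have T4 : 4 * r <= T by rewrite -mulrA in hT; lra.
have T0 : 0 < T by lra.
have volE (x : R) : 0 < x -> lvol (lpball p (0 : 'rV[R]_n) (x * r)) = (x ^+ n)%:E.
  exact: (lvol_lpballE p1 r1).
have g20 : 0 < 2 * g by lra.
have e1 : 0 < 2 ^+ n :> R by rewrite exprn_gt0.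
have e2 : 0 < (2 * g) ^+ n by rewrite exprn_gt0.
have v1 : (lvol (lpball p (0 : 'rV[R]_n) (2 * r)) <= (2 ^+ n)%:E)%E by rewrite volE.
have v2 : (lvol (lpball p (0 : 'rV[R]_n) (2 * g * r)) <= ((2 * g) ^+ n)%:E)%E.
  by rewrite volE.
have [h1 h10 H1] := grid_count_le_lvol (lpball_compact p1) v1 e1.
have [h2 h20 H2] := grid_count_le_lvol (lpball_compact p1) v2 e2.
(* [h <= 1] gives [D >= 1], and [n * h <= r] keeps the rounded points of the ball of radius
   [T - 2 * r] in [inside]. *)
pose h := Num.min (Num.min h1 h2) (Num.min 1 (r / n%:R)).
have h0 : 0 < h by rewrite !lt_min h10 h20 ltr01 divr_gt0.
have hh1 : h <= h1 by rewrite !ge_min lexx.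
have hh2 : h <= h2 by rewrite !ge_min lexx orbT.
have hh3 : h <= 1 by rewrite !ge_min lexx !orbT.
have hh4 : n%:R * h <= r.
  by rewrite mulrC -ler_pdivlMr// !ge_min lexx !orbT.
have hn0 : 0 < h ^+ n by rewrite exprn_gt0.
have [m hm] := exists_grid_size (2 * T) h0.
pose s : 'rV[R]_n := const_mx (- T).
pose inside (f : {ffun 'I_n -> 'I_m}) := lpnorm p (0 - grid s h f) <= T - r.
pose V : finType := {f | inside f}.
pose pt (v : V) := grid s h (val v).
(* Moving the grid instead of the ball lets one mesh serve all centres. *)
have grid_shift (x : 'rV[R]_n) f : grid (s - x) h f = grid s h f - x :> 'rV[R]_n.
  by apply/rowP => j; rewrite !mxE addrAC.
pose d := (2 ^+ n + 2 ^+ n) / h ^+ n.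
pose D := ((2 * g) ^+ n + (2 * g) ^+ n) / h ^+ n.
have cnt1 (S : {set V}) (x : 'rV[R]_n) :
    (forall v, v \in S -> lpnorm p (pt v - x) <= 2 * r) -> #|S|%:R <= d.
  move=> hS; rewrite (ler_pdivlMr _ _ hn0) -(card_imset _ val_inj).
  apply: (H1 h m (s - x) _ h0 hh1) => _ /imsetP[v vS ->].
  by rewrite /lpball/= sub0r lpnormN// grid_shift; exact: hS.
have cnt2 (S : {set V}) (x : 'rV[R]_n) :
    (forall v, v \in S -> lpnorm p (pt v - x) <= g * (2 * r)) -> #|S|%:R <= D.
  move=> hS; rewrite (ler_pdivlMr _ _ hn0) -(card_imset _ val_inj).
  apply: (H2 h m (s - x) _ h0 hh2) => _ /imsetP[v vS ->].
  rewrite /lpball/= sub0r lpnormN// grid_shift.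
  have -> : 2 * g * r = g * (2 * r) by ring.
  exact: hS.
have D1 : 1 <= D.
  rewrite ler_pdivlMr// mul1r.
  have : 1 <= (2 * g) ^+ n by apply: exprn_ege1; lra.
  have : h ^+ n <= 1 by apply: exprn_ile1; [exact: ltW|].
  by lra.
have gn0 : 0 < g ^+ n by rewrite exprn_gt0.
(* The mesh cancels, so the logarithm is linear in [n] however fine the grid is. *)
have dD : d / (2 * D) = (g ^+ n)^-1 / 2.
  rewrite /d /D exprMn.
  move: (2 ^+ n) (g ^+ n) (h ^+ n) e1 gn0 hn0 => x y z x0 y0 z0.
  field; apply/and3P; split; rewrite lt0r_neq0//.
  by rewrite addr_gt0// mulr_gt0.
have lng : ln (d / (2 * D)) = - ln g * n%:R - ln 2.
  rewrite dD lnM ?posrE ?invr_gt0// !lnV ?posrE// lnXn//.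
  by rewrite mulNr mulr_natr.
have Dd : 2 * D <= d.
  have : 0 <= ln (d / (2 * D)).
    have l2 : 0 < ln 2 :> R by rewrite ln_gt0// ltr1n.
    by rewrite lng; lra.
  rewrite leNgt => hl; rewrite leNgt; apply: contra hl => hl.
  have d0 : 0 < d by rewrite divr_gt0// addr_gt0.
  have D20 : 0 < 2 * D by lra.
  by rewrite ln_lt0// divr_gt0//= (ltr_pdivrMr _ _ D20) mul1r.
have r20 : 0 < 2 * r by lra.
have [I Isep hI] := separated_subset p1 g2 r0
  (fun a b => uc a b (2 * r) r20) cnt1 cnt2 D1 Dd.
pose P := [set pt i | i in [set` I]].
exists P.
  move=> _ _ [i iI <-] [j jI <-] ij.
  apply/seteqP; split => // z [/interior_subset zi /interior_subset zj].
  have ij' : i != j by apply/eqP => eij; apply: ij; rewrite eij.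
  have := Isep i j iI jI ij'; rewrite ltNge => /negP; apply.
  apply: (le_trans (lpnorm_triangle p1 _ z _)).
  rewrite mulr_natl; apply: lerD; first exact: zi.
  by rewrite lpnorm_distC//; exact: zj.
have cT i : i \in I -> lpnorm p (pt i) <= T - r.
  by move=> _; have := valP i; rewrite /inside sub0r lpnormN.
have U := @lvol_union_ge R p n r T p1 n0 r0 r1 V I pt cT Isep.
pose X := lpball p (0 : 'rV[R]_n) T `&` \bigcup_(x in P) lpball p x r.
rewrite -/P -/X in U.
have Tr : 0 < T / r by rewrite divr_gt0.
have volT : lvol (lpball p (0 : 'rV[R]_n) T) = ((T / r) ^+ n)%:E.
  by rewrite -(volE _ Tr) divfK// gt_eqF.
have XT : (lvol X <= ((T / r) ^+ n)%:E)%E.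
  by rewrite -volT; apply: lvol_mono => x [].
rewrite /cover_ratio -/X volT/=.
have hI2 : #|I|%:R / 2 <= fine (lvol X).
  by move: U XT; case: (lvol X) => [x|//|//]; rewrite lee_fin.
have Vc : ((T - 2 * r) / r) ^+ n <= #|V|%:R * h ^+ n.
  have := @lvol_lpball_le_count R p n p1 n0 0 s (T - 2 * r) h m h0.
  have -> : lvol (lpball p (0 : 'rV[R]_n) (T - 2 * r)) = (((T - 2 * r) / r) ^+ n)%:E.
    by rewrite -volE ?divfK ?gt_eqF// divr_gt0//; lra.
  rewrite lee_fin => cnt; apply: (le_trans (cnt _)).
    move=> y; rewrite /lpball/= sub0r lpnormN// => yT.
    by apply: (lpball_in_grid p1 hm); apply: (le_trans yT); lra.
  rewrite (ler_pM2r hn0) card_sig ler_nat.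
  apply: subset_leq_card; apply/fintype.subsetP => f; rewrite finset.in_set => hf.
  rewrite /inside unfold_in; apply: (le_trans hf); lra.
(* Bernoulli with [T >= 4 * n * r]. *)
have TT : (T / r) ^+ n / 2 <= ((T - 2 * r) / r) ^+ n.
  have -> : (T - 2 * r) / r = (1 - 2 * r / T) * (T / r).
    by field; rewrite !gt_eqF.
  rewrite [leRHS]exprMn [leLHS]mulrC ler_pM2r ?exprn_gt0//.
  have nrT : n%:R * (2 * r / T) <= 2^-1.
    by rewrite mulrA ler_pdivrMr//; lra.
  have rT0 : 0 <= 2 * r / T by rewrite divr_ge0 ?(ltW T0)// ltW.
  apply: le_trans (bernoulli_le n _).
    by move: (n%:R * (2 * r / T)) nrT => u; lra.
  by rewrite rT0 ler_pdivrMr//; lra.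
have q0 : 0 < (T / r) ^+ n by rewrite exprn_gt0.
rewrite ler_pdivlMr//; apply: le_trans hI2.
pose L := ln (d / (2 * D)).
have L1 : - ln g * n%:R / 2 <= L by rewrite /L lng; lra.
have L0 : 0 <= L.
  apply: le_trans L1; apply: le_trans hn.
  by rewrite ln_ge0// ler1n.
have hI3 : #|V|%:R * h ^+ n * L / (64 * 2 ^+ n) <= #|I|%:R.
  apply: le_trans hI; rewrite -/L le_eqVlt; apply/orP; left; apply/eqP.
  by rewrite /d; field; rewrite !gt_eqF.
have : (T / r) ^+ n / 2 * L / (64 * 2 ^+ n) <= #|I|%:R.
  apply: le_trans hI3; rewrite ler_pM2r ?invr_gt0 ?mulr_gt0//.
  by rewrite ler_wpM2r//; exact: le_trans Vc.
have : (T / r) ^+ n / 2 * (- ln g * n%:R / 2) / (64 * 2 ^+ n) <=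
    (T / r) ^+ n / 2 * L / (64 * 2 ^+ n).
  by rewrite ler_pM2r ?invr_gt0 ?mulr_gt0// ler_pM2l// divr_gt0.
have -> : - ln g / 512 * n%:R / 2 ^+ n * (T / r) ^+ n =
    (T / r) ^+ n / 2 * (- ln g * n%:R / 2) / (64 * 2 ^+ n) / 2.
  by field; rewrite !gt_eqF.
move: (_ / (64 * 2 ^+ n)) (_ / (64 * 2 ^+ n)) (#|I|%:R) => u v w *.
lra.
Qed.

Theorem theorem1 (R : realType) (p : R) (hp1 : 1 < p) (hp2 : p <= 2) :
  exists c : R, 0 < c < 2 /\
    exists g : nat -> R, g @ \oo --> 0 /\
      \forall n \near \oo,
        (((1 + g n) * (ln (2 / c) * n%:R / 2 ^+ n))%:E <= Delta p n)%E.
Proof.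
have [g /andP[g2 g1] uc] := lpnorm_uniformly_convex hp1.
have g0 : 0 < g by lra.
have lg : ln g < 0 by rewrite ln_lt0// g0.
(* With [c = 2 * E], the logarithm of [2 / c] is exactly the constant of [dense_packing]. *)
pose E := expR (- (- ln g / 512)).
have E0 : 0 < E by exact: expR_gt0.
have E1 : E < 1 by rewrite /E expR_lt1; lra.
exists (2 * E); split; first by apply/andP; split; lra.
exists (fun=> 0); split; first exact: cvg_cst.
have -> : ln (2 / (2 * E)) = - ln g / 512.
  have -> : 2 / (2 * E) = expR (- ln g / 512).
    by rewrite /E expRN; field; rewrite ?gt_eqF ?expR_gt0.
  by rewrite expRK.
(* From this threshold on, [ln 2] is at most half of [- ln g * n]. *)
exists (Num.truncn (ln 2 / (- ln g / 2))).+1 => // n /= hn.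
have n0 : (0 < n)%N by exact: leq_trans hn.
have hn2 : ln 2 <= - ln g * n%:R / 2.
  have /ltW : ln 2 / (- ln g / 2) < n%:R.
    by apply: lt_le_trans (truncnS_gt _) _; rewrite ler_nat.
  by rewrite ler_pdivrMr; lra.
rewrite addr0 mul1r.
have [r r0 r1] := exists_unit_radius (ltW hp1) n0.
(* For every lower bound [M] on the radius, one sufficiently large [T >= M] with a dense packing
   bounds the supremum from below. *)
apply: le_ereal_inf_tmp => _ [M _ <-].
pose T := Num.max M (4 * n%:R * r).
have [P packP hP] := @dense_packing R p g r T n hp1 n0 ltac:(by rewrite g2) (uc n) r0 r1
  ltac:(by rewrite le_max lexx orbT) hn2.
apply: (@le_trans _ _ (cover_ratio p r T P)%:E); first by rewrite lee_fin.
apply: ereal_sup_ubound; exists T, r, P; split => //.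
by rewrite le_max lexx.
Qed.
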